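(* Let $G=SL_2(\mathbb{R})$, $\Gamma\le G$ a lattice, $X=G/\Gamma$, $\mu$ the $G$-invariant probability measure on $X$, and $u_t=\begin{pmatrix}1&t\\0&1\end{pmatrix}$. Let $f:X\to\mathbb{R}$ be a bounded Lipschitz function with $\int_X f\,d\mu=0$ such that $(X,u_t)$ is polynomially mixing for $f$ with some rate $\alpha>0$, i.e. there is $C>0$ with $|\langle f\circ u_n,f\rangle|\le C n^{-\alpha}$ for all integers $n\ge1$. Let $\{a_n\}_{n\in\mathbb{N}}\subset\mathbb{N}$ be an increasing sequence growing polynomially with rate $d$, i.e. $a_n\le C' n^d$ for some $C'>0$, $d\in\mathbb{N}$. Then there is $\alpha'=\alpha'(d,\alpha,\Gamma)>0$ such that $$\dim_H\Big(\Big\{x\in X:\ \limsup_{N\to\infty}\Big|\frac1N\sum_{i=1}^N f(u_{a_i}.x)\Big|>0\Big\}\Big)\le 3-\frac{\alpha'}{d}.$$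
   Context: $G$ acts on $X$ by left multiplication; $\langle g,h\rangle=\int_X g\overline{h}\,d\mu$. $X$ carries the metric induced by a right-invariant Riemannian metric on $G$; ''Lipschitz'' and $\dim_H$ (Hausdorff dimension) refer to this metric. *)

(* Defs.v *)
From HB Require Import structures.
From mathcomp Require Import all_boot all_order all_algebra.
From mathcomp Require Import all_classical all_reals all_analysis.
Set Implicit Arguments. Unset Strict Implicit. Unset Printing Implicit Defensive.
Import Order.TTheory GRing.Theory Num.Theory.
Import numFieldNormedType.Exports.
Local Open Scope classical_set_scope.
Local Open Scope ring_scope.

Section Defs.
Variable R : realType.

Definition SL2 (M : 'M[R]_2) : Prop := \det M = 1.

Definition u (t : R) : 'M[R]_2 :=
  \matrix_(i < 2, j < 2) ((i == j)%:R + (((i : nat) == 0%N) && ((j : nat) == 1%N))%:R * t).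

Definition is_subgroup (Gam : set 'M[R]_2) : Prop :=
  Gam `<=` SL2 /\ Gam 1%:M /\ (forall a b, Gam a -> Gam b -> Gam (a *m b)) /\
  (forall a, Gam a -> Gam (invmx a)).

(* Gamma is discrete (identity isolated; equivalent for subgroups) *)
Definition is_discrete (Gam : set 'M[R]_2) : Prop :=
  exists r : R, 0 < r /\ forall g, Gam g ->
    (forall i j, `|g i j - (1%:M : 'M[R]_2) i j| < r) -> g = 1%:M.

Definition coset (Gam : set 'M[R]_2) (g : 'M[R]_2) : set 'M[R]_2 :=
  [set g *m x | x in Gam].
Definition is_coset (Gam : set 'M[R]_2) (S : set 'M[R]_2) : Prop :=
  exists g, SL2 g /\ S = coset Gam g.
Definition Xq (Gam : set 'M[R]_2) := {S : set 'M[R]_2 | is_coset Gam S}.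

Lemma SL2_1 : SL2 1%:M. Proof. by rewrite /SL2 det1. Qed.
Definition Xq_pt (Gam : set 'M[R]_2) : Xq Gam :=
  exist _ (coset Gam 1%:M) (ex_intro _ 1%:M (conj SL2_1 erefl)).

Definition act_set (g : 'M[R]_2) (S : set 'M[R]_2) := [set g *m s | s in S].
Lemma act_is_coset Gam g S : SL2 g -> is_coset Gam S -> is_coset Gam (act_set g S).
Proof.
move=> Hg [h [Hh ->]]; exists (g *m h); split.
  by rewrite /SL2 det_mulmx Hg Hh mulr1.
rewrite /act_set /coset; apply/seteqP; split => y.
  by move=> [s [x Gx <-] <-]; exists x => //; rewrite mulmxA.
by move=> [x Gx <-]; exists (h *m x); [exists x|rewrite mulmxA].
Qed.
Definition act (Gam : set 'M[R]_2) (g : 'M[R]_2) (x : Xq Gam) : Xq Gam :=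
  match pselect (SL2 g) with
  | left H => exist _ (act_set g (proj1_sig x)) (act_is_coset H (proj2_sig x))
  | right _ => x
  end.

(* right-invariant Riemannian metric on G, given by an inner product on
   the Lie algebra (restriction of a positive definite form B on M_2(R)) *)
Definition posdef (B : 'M[R]_(2 * 2)) : Prop :=
  B^T = B /\ forall v : 'rV[R]_(2 * 2), v != 0 -> 0 < (v *m B *m v^T) 0 0.
Definition qnorm (B : 'M[R]_(2 * 2)) (A : 'M[R]_2) : R :=
  Num.sqrt ((mxvec A *m B *m (mxvec A)^T) 0 0).

Definition dcurve (c : R -> 'M[R]_2) (i j : 'I_2) : R -> R := fun s => c s i j.
Definition curve_deriv (c : R -> 'M[R]_2) (t : R) : 'M[R]_2 :=
  \matrix_(i < 2, j < 2) derive1 (dcurve c i j) t.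
Definition admissible (g h : 'M[R]_2) (c : R -> 'M[R]_2) : Prop :=
  (forall i j, (forall t, derivable (dcurve c i j) t 1) /\
               continuous (derive1 (dcurve c i j))) /\
  (forall t, 0 <= t <= 1 -> SL2 (c t)) /\ c 0 = g /\ c 1 = h.
(* length w.r.t. the right-invariant metric: |c'(t)|_{c(t)} = |c'(t) c(t)^-1|_B *)
Definition curve_length (B : 'M[R]_(2 * 2)) (c : R -> 'M[R]_2) : \bar R :=
  (\int[lebesgue_measure]_(t in `[0%R, 1%R]) (qnorm B (curve_deriv c t *m invmx (c t)))%:E)%E.
Definition distG (B : 'M[R]_(2 * 2)) (g h : 'M[R]_2) : \bar R :=
  ereal_inf [set curve_length B c | c in admissible g h].
Definition distX (B : 'M[R]_(2 * 2)) (Gam : set 'M[R]_2) (x y : Xq Gam) : \bar R :=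
  ereal_inf [set r | exists g h, proj1_sig x g /\ proj1_sig y h /\ r = distG B g h].

Definition ediam {T} (D : T -> T -> \bar R) (U : set T) : \bar R :=
  ereal_sup [set r | exists x y, U x /\ U y /\ r = D x y].
Definition cover_term {T} (D : T -> T -> \bar R) (s : R) (U : set T) : \bar R :=
  if asbool (U = set0) then 0%E else ((fine (ediam D U)) `^ s)%:E.
Definition hcontent {T} (D : T -> T -> \bar R) (s delta : R) (A : set T) : \bar R :=
  ereal_inf [set (\sum_(0 <= i <oo) cover_term D s (U i))%E |
    U in [set U : nat -> set T | A `<=` \bigcup_i U i /\
                                 forall i, (ediam D (U i) <= delta%:E)%E]].
Definition hmeasure {T} (D : T -> T -> \bar R) (s : R) (A : set T) : \bar R :=
  ereal_sup [set hcontent D s delta A | delta in [set delta : R | 0 < delta]].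
Definition hdim {T} (D : T -> T -> \bar R) (A : set T) : \bar R :=
  ereal_inf [set s%:E | s in [set s : R | 0 <= s /\ hmeasure D s A = 0%E]].

End Defs.

HB.instance Definition _ (R : realType) (Gam : set 'M[R]_2) :=
  gen_eqMixin (Xq Gam).
HB.instance Definition _ (R : realType) (Gam : set 'M[R]_2) :=
  gen_choiceMixin (Xq Gam).
HB.instance Definition _ (R : realType) (Gam : set 'M[R]_2) :=
  isPointed.Build (Xq Gam) (Xq_pt Gam).

Definition openX (R : realType) (B : 'M[R]_(2 * 2)) (Gam : set 'M[R]_2) : set (set (Xq Gam)) :=
  [set A | forall x, A x -> exists r : R, (0 < r)%R /\
       [set y | (distX B x y < r%:E)%E] `<=` A].
Definition XM (R : realType) (B : 'M[R]_(2 * 2)) (Gam : set 'M[R]_2) :=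
  g_sigma_algebraType (@openX R B Gam).

Definition avg (R : realType) (Gam : set 'M[R]_2) (f : Xq Gam -> R) (a : nat -> nat)
  (x : Xq Gam) (N : nat) : R :=
  (N%:R^-1 * \sum_(1 <= i < N.+1) f (act (u (a i)%:R) x))%R.

(* Main.v *)
(** The proof is a second moment bound combined with a packing argument.

Polynomial mixing and the invariance of [mu] give
[int |S_N / N|^2 <= C N^(-b)], hence a power saving for the measure of
[{x : |S_N x / N| > e}].  Conjugation by [u_a] expands distances by at most
[O((1 + a)^2)], so [S_N / N] is nearly constant on balls of radius
[r = c N^(-2d)].  A maximal family of disjoint [r]-balls centred in the
exceptional set lies in a slightly larger exceptional set, and each such ball
has measure at least [c r^3] when its centre [g Gamma] has bounded [g]; this
bounds the number of [r]-balls needed for a cover.  Along [N = k^(2m)], with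
[e = 1/k] and [|g| <= k], the covering sums of dimension [3 - 1/(8md)] are
[O(k^(-2))], and [limsup |S_N / N| > 0] forces membership in infinitely many of
these exceptional sets.

The bound [mu(ball) >= c r^3] uses neither Haar measure nor the injectivity
radius: a compact part of [SL_2(R)] is covered by [O(n^3)] left translates of
the [1/n]-neighbourhood of the identity, and all translates of the
corresponding subset of [X] have the same measure.

The triangle inequality for the Riemannian distance is avoided altogether: near
the diagonal [distX x y] is comparable with the least [|k - 1|] over
[k x = y]. *)

Require Import Defs.
From HB Require Import structures.
From mathcomp Require Import all_boot all_order all_algebra.
From mathcomp Require Import all_classical all_reals all_analysis.
From mathcomp Require Import measurable_realfun ring lra zify.
Set Implicit Arguments. Unset Strict Implicit. Unset Printing Implicit Defensive.
Import Order.TTheory GRing.Theory Num.Theory.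
Import numFieldNormedType.Exports.
Local Open Scope classical_set_scope.
Local Open Scope ring_scope.

(** * Two by two matrices and the action on the quotient *)

Section Matrices.
Variable R : realType.
Implicit Types (g h k A : 'M[R]_2) (r s : R).

Lemma ord2P (P : 'I_2 -> Prop) : P 0 -> P 1 -> forall i, P i.
Proof.
move=> P0 P1 [[|[|//]] Hi].
  by rewrite (_ : Ordinal Hi = 0) //; apply: val_inj.
by rewrite (_ : Ordinal Hi = 1) //; apply: val_inj.
Qed.

Lemma sum_ord2 (F : 'I_2 -> R) : \sum_i F i = F 0 + F 1.
Proof. by rewrite !big_ord_recl big_ord0 addr0; congr (_ + F _); apply: val_inj. Qed.

Lemma mulmx2E A h i j : (A *m h) i j = A i 0 * h 0 j + A i 1 * h 1 j.
Proof. by rewrite mxE sum_ord2. Qed.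

Lemma det2E A : \det A = A 0 0 * A 1 1 - A 0 1 * A 1 0.
Proof.
rewrite (expand_det_row _ 0) sum_ord2 /cofactor !det_mx11 !mxE /=.
rewrite !expr0 !mul1r ?addn0 /= ?expr1 ?mulN1r ?mulrN.
by congr (_ * A _ _ - _ * A _ _); apply: val_inj.
Qed.

Lemma one2E i j : (1%:M : 'M[R]_2) i j = (i == j)%:R.
Proof. by rewrite mxE. Qed.

Lemma SL2E g : SL2 g <-> g 0 0 * g 1 1 - g 0 1 * g 1 0 = 1.
Proof. by rewrite /SL2 det2E. Qed.

Lemma SL2_unit g : SL2 g -> g \in unitmx.
Proof. by rewrite /SL2 unitmxE => ->; rewrite unitr1. Qed.

Lemma SL2_mul g h : SL2 g -> SL2 h -> SL2 (g *m h).
Proof. by rewrite /SL2 det_mulmx => -> ->; rewrite mulr1. Qed.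

Lemma SL2_inv g : SL2 g -> SL2 (invmx g).
Proof. by rewrite /SL2 det_inv => ->; rewrite invr1. Qed.

Lemma SL2_mulKmx g h : SL2 g -> invmx g *m (g *m h) = h.
Proof. by move=> /SL2_unit gu; rewrite mulKmx. Qed.
Lemma SL2_mulVKmx g h : SL2 g -> g *m (invmx g *m h) = h.
Proof. by move=> /SL2_unit gu; rewrite mulKVmx. Qed.
Lemma SL2_mulmxKV g h : SL2 g -> h *m invmx g *m g = h.
Proof. by move=> /SL2_unit gu; rewrite mulmxKV. Qed.

Definition mat2 (a b c d : R) : 'M[R]_2 :=
  \matrix_(i, j) if i == 0 then (if j == 0 then a else b)
                 else (if j == 0 then c else d).

Lemma mat2E a b c d : (mat2 a b c d 0 0 = a) * (mat2 a b c d 0 1 = b) *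
  (mat2 a b c d 1 0 = c) * (mat2 a b c d 1 1 = d).
Proof. by rewrite !mxE. Qed.

Lemma matrix2P A h : A 0 0 = h 0 0 -> A 0 1 = h 0 1 -> A 1 0 = h 1 0 ->
  A 1 1 = h 1 1 -> A = h.
Proof. by move=> *; apply/matrixP; elim/ord2P; elim/ord2P. Qed.

Lemma SL2_invE g : SL2 g -> invmx g = mat2 (g 1 1) (- g 0 1) (- g 1 0) (g 0 0).
Proof.
move=> Hg; have gu := SL2_unit Hg; have /SL2E e := Hg.
rewrite -[RHS](mulKmx gu) -[LHS]mulmx1; congr (_ *m _).
by apply: matrix2P; rewrite mulmx2E one2E !mat2E /= -?e; ring.
Qed.

Definition mxle A r := forall i j, `|A i j| <= r.

Lemma mxle_ge0 A r : mxle A r -> 0 <= r.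
Proof. by move=> /(_ 0 0); exact: le_trans. Qed.

Lemma mxleW A r s : r <= s -> mxle A r -> mxle A s.
Proof. by move=> rs H i j; exact: le_trans (H i j) rs. Qed.

Lemma mxleD A h r s : mxle A r -> mxle h s -> mxle (A + h) (r + s).
Proof. by move=> H1 H2 i j; rewrite mxE (le_trans (ler_normD _ _))// lerD. Qed.

Lemma mxleB A h r s : mxle A r -> mxle h s -> mxle (A - h) (r + s).
Proof. by move=> H1 H2; apply: mxleD => // i j; rewrite mxE normrN. Qed.

Lemma mxleM A h r s : mxle A r -> mxle h s -> mxle (A *m h) (2 * (r * s)).
Proof.
move=> H1 H2 i j; rewrite mulmx2E (le_trans (ler_normD _ _))// !normrM.
by rewrite mulr_natl mulr2n lerD// ler_pM.
Qed.

Lemma mxle_inv g r : SL2 g -> mxle g r -> mxle (invmx g) r.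
Proof.
move=> Hg H; rewrite SL2_invE// => i j.
by elim/ord2P: i; elim/ord2P: j; rewrite mat2E ?normrN; apply: H.
Qed.

Lemma mxle1 : mxle (1%:M : 'M[R]_2) 1.
Proof. by move=> i j; rewrite one2E; case: eqP; rewrite ?normr1// normr0. Qed.

Lemma mxle_exists A : exists n : nat, mxle A n%:R.
Proof.
pose s := \sum_i \sum_j `|A i j|.
exists (Num.bound s) => i j.
have s0 : 0 <= s by apply: sumr_ge0 => ? _; apply: sumr_ge0.
apply: le_trans (ltW (archi_boundP s0)).
rewrite /s !sum_ord2; elim/ord2P: i; elim/ord2P: j;
have := normr_ge0 (A 0 0); have := normr_ge0 (A 0 1);
have := normr_ge0 (A 1 0); have := normr_ge0 (A 1 1); lra.
Qed.

(** Stands in for a metric ball around the identity of the group: an explicit entrywise condition,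
    strict so that the sets built from it are open. *)
Definition near1 r k := SL2 k /\ forall i j, `|k i j - (1%:M : 'M[R]_2) i j| < r.

Lemma near1_mxle r k : near1 r k -> mxle (k - 1%:M) r.
Proof. by move=> [_ H] i j; have := H i j; rewrite !mxE; apply: ltW. Qed.

Lemma near1_SL2 r k : near1 r k -> SL2 k. Proof. by case. Qed.
Hint Resolve near1_SL2 : core.

Lemma mxle_near1 r s k : SL2 k -> r < s -> mxle (k - 1%:M) r -> near1 s k.
Proof. by move=> ? rs H; split => // i j; have := H i j; rewrite !mxE; move/le_lt_trans; apply. Qed.

Lemma near1W r s k : r <= s -> near1 r k -> near1 s k.
Proof. by move=> rs [? H]; split => // i j; exact: lt_le_trans (H i j) rs. Qed.

Lemma near1_le r k : near1 r k -> mxle k (1 + r).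
Proof.
by move=> H; rewrite -(addrNK 1%:M k) addrC; apply: mxleD mxle1 (near1_mxle H).
Qed.

Lemma near1_gt0 r k : near1 r k -> 0 < r.
Proof. by move=> [_ /(_ 0 0)]; apply: le_lt_trans. Qed.

(** [g k g^-1 - 1 = g (k - 1) g^-1], and each product of two by two matrices costs a factor 2,
    giving [4 K^2 r]; doubling it makes the bound strict. Applied to [u_a], this is the quadratic
    expansion of the unipotent flow. *)
Lemma near1_conj r K g k : SL2 g -> 0 < K -> mxle g K -> near1 r k ->
  near1 (8 * K ^+ 2 * r) (g *m k *m invmx g).
Proof.
move=> Hg K0 gK kr; have r0 := near1_gt0 kr.
apply: (@mxle_near1 (2 * (2 * (K * r) * K))).
- by do 2?apply: SL2_mul; eauto; exact: SL2_inv.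
- have : 0 < K ^+ 2 * r by rewrite mulr_gt0// exprn_gt0.
  lra.
have -> : g *m k *m invmx g - 1%:M = g *m (k - 1%:M) *m invmx g.
  by rewrite mulmxBr mulmxBl mulmx1 mulmxV// SL2_unit.
by apply: mxleM (mxle_inv Hg gK); apply: mxleM gK (near1_mxle kr).
Qed.

(** [k1 k2^-1 - 1 = (k1 - k2) k2^-1] has entries at most [4 r (1 + r) <= 8 r]. This takes the place
    of a triangle inequality. *)
Lemma near1_div r k1 k2 : r <= 1 -> near1 r k1 -> near1 r k2 ->
  near1 (9 * r) (k1 *m invmx k2).
Proof.
move=> r1 H1 H2; have r0 := near1_gt0 H1.
apply: (@mxle_near1 (2 * ((r + r) * (1 + r)))).
- by apply: SL2_mul; eauto; apply: SL2_inv; eauto.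
- have : 0 <= r * (1 - r) by rewrite mulr_ge0 ?subr_ge0// ltW.
  lra.
have -> : k1 *m invmx k2 - 1%:M = ((k1 - 1%:M) - (k2 - 1%:M)) *m invmx k2.
  rewrite opprB addrA subrK mulmxBl mulmxV//; apply: SL2_unit; eauto.
apply: mxleM; first by apply: mxleB; exact: near1_mxle.
by apply: mxle_inv; eauto; exact: near1_le.
Qed.

(** Inversion in determinant one swaps the diagonal entries and changes the sign of the others, so
    no constant is lost. *)
Lemma near1_inv r k : near1 r k -> near1 r (invmx k).
Proof.
move=> [Hk H]; split; first exact: SL2_inv.
move: H; rewrite SL2_invE// => H i j.
have := H (1 - i) (1 - j); have := H i j.
elim/ord2P: i; elim/ord2P: j; rewrite !mat2E !one2E /= ?(subrr, subr0)//.
- by rewrite normrN.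
- by rewrite normrN.
Qed.

Lemma SL2_u (t : R) : SL2 (u t).
Proof. by apply/SL2E; rewrite !mxE /=; ring. Qed.

Lemma u_add (s t : R) : u s *m u t = u (s + t).
Proof. by apply: matrix2P; rewrite mulmx2E !mxE /=; ring. Qed.

Lemma mxle_u (t : R) : 0 <= t -> mxle (u t) (1 + t).
Proof. by move=> t0; elim/ord2P; elim/ord2P; rewrite !mxE /= ger0_norm; lra. Qed.

End Matrices.
#[export] Hint Resolve near1_SL2 : core.

Section Action.
Variables (R : realType) (Gam : set 'M[R]_2).
Hypothesis HGsub : is_subgroup Gam.
Implicit Types (g h k : 'M[R]_2) (x y : Xq Gam).

Let x0 := Xq_pt Gam.

Lemma Xq_eq x y : proj1_sig x = proj1_sig y -> x = y.
Proof. by case: x y => [S HS] [S' HS'] /= e; apply: eq_exist. Qed.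

Lemma act_val g x : SL2 g -> proj1_sig (act g x) = act_set g (proj1_sig x).
Proof. by rewrite /act; case: pselect. Qed.

Lemma actM g h x : SL2 g -> SL2 h -> act g (act h x) = act (g *m h) x.
Proof.
move=> Hg Hh; apply: Xq_eq; rewrite !act_val//; last exact: SL2_mul.
rewrite /act_set; apply/seteqP; split => y /=.
  by move=> [_ [s Hs <-] <-]; exists s => //; rewrite mulmxA.
by move=> [s Hs <-]; exists (h *m s); [exists s|rewrite mulmxA].
Qed.

Lemma act1 x : act 1%:M x = x.
Proof.
apply: Xq_eq; rewrite act_val; last exact: SL2_1.
apply/seteqP; split => y /=; first by move=> [s Hs <-]; rewrite mul1mx.
by move=> Hy; exists y => //; rewrite mul1mx.
Qed.

Lemma actK g x : SL2 g -> act (invmx g) (act g x) = x.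
Proof. by move=> Hg; rewrite actM ?SL2_inv// ?mulVmx ?act1// ?SL2_unit//; exact: SL2_inv. Qed.

Lemma act_pt_val g : SL2 g -> proj1_sig (act g x0) = coset Gam g.
Proof.
move=> Hg; rewrite act_val// /act_set /coset; apply/seteqP; split => y /=.
  by move=> [_ [s Hs <-] <-]; exists s => //; rewrite mul1mx.
by move=> [s Hs <-]; exists s => //; exists s => //; rewrite mul1mx.
Qed.

(** Turns membership in a coset into an equation in the orbit of the base point; the subgroup laws
    absorb the factor from [Gam]. *)
Lemma act_ptP g x : proj1_sig x g <-> SL2 g /\ x = act g x0.
Proof.
case: HGsub => HG1 [HG2 [HGM HGV]].
split=> [|[Hg ->]]; last by rewrite act_pt_val//; exists 1%:M => //; rewrite mulmx1.
case: (proj2_sig x) => h [Hh ex]; rewrite ex => -[s Hs <-].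
have Hs' := HG1 _ Hs; have Hhs := SL2_mul Hh Hs'.
split => //; apply: Xq_eq; rewrite act_pt_val// ex.
apply/seteqP; split => y /= [t Ht <-].
  exists (invmx s *m t); first by apply: HGM => //; exact: HGV.
  by rewrite -mulmxA SL2_mulVKmx.
by exists (s *m t); [exact: HGM|rewrite mulmxA].
Qed.

Lemma act_transitive x : exists2 g, SL2 g & x = act g x0.
Proof.
case: (proj2_sig x) => h [Hh ex]; exists h => //.
by apply: Xq_eq; rewrite act_pt_val.
Qed.

(** The substitute for metric balls in the quotient: the orbit of [x] under a neighbourhood of the
    identity. *)
Definition ball_act (r : R) x : set (Xq Gam) := [set act k x | k in near1 r].

End Action.

(** * Comparison of the Riemannian distance with matrix entries *)

Section QuadraticForm.
Variables (R : realType) (B : 'M[R]_(2 * 2)).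
Hypothesis HB : posdef B.
Implicit Types v w : 'rV[R]_(2 * 2).

Let Q v w : R := (v *m B *m w^T) 0 0.

Let Q_sym v w : Q v w = Q w v.
Proof.
rewrite /Q; have -> : v *m B *m w^T = (w *m B *m v^T)^T.
  by rewrite !trmx_mul trmxK (proj1 HB) mulmxA.
by rewrite mxE.
Qed.

Let Q_ge0 v : 0 <= Q v v.
Proof.
have [->|v0] := eqVneq v 0; first by rewrite /Q mul0mx mul0mx mxE.
exact/ltW/(proj2 HB).
Qed.

(** The form is evaluated at [Q(w,w) v - Q(v,w) w], where it equals [Q(w,w)] times the difference of
    the two sides. *)
Lemma posdef_Cauchy_Schwarz v w : Q v w ^+ 2 <= Q v v * Q w w.
Proof.
have [->|w0] := eqVneq w 0.
  by rewrite /Q trmx0 !mulmx0 !mxE expr0n mulr0.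
have c0 : 0 < Q w w by exact: (proj2 HB).
have QBl x y z : Q (x - y) z = Q x z - Q y z by rewrite /Q !mulmxBl !mxE.
have QBr x y z : Q z (x - y) = Q z x - Q z y by rewrite !(Q_sym z) QBl.
have QZl a x z : Q (a *: x) z = a * Q x z by rewrite /Q -!scalemxAl mxE.
have QZr a x z : Q z (a *: x) = a * Q z x by rewrite !(Q_sym z) QZl.
have := Q_ge0 (Q w w *: v - Q v w *: w).
rewrite (_ : Q _ _ = Q w w * (Q v v * Q w w - Q v w ^+ 2)); last first.
  by rewrite !(QBl, QBr, QZl, QZr) (Q_sym w v); ring.
by rewrite pmulr_rge0// subr_ge0.
Qed.

Let B_unit : B \in unitmx.
Proof.
rewrite -row_free_unit; apply/row_freeP; apply/row_freeP.
rewrite -kermx_eq0; apply/eqP/row_matrixP => i; rewrite row0.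
apply/eqP/negPn/negP => vn0.
have := proj2 HB _ vn0.
by rewrite (sub_kermxP (row_sub i (kermx B))) mul0mx mxE ltxx.
Qed.

Lemma qnorm_ge0 (A : 'M[R]_2) : 0 <= qnorm B A.
Proof. exact: sqrtr_ge0. Qed.

(** Each coordinate is the product under [Q] with a fixed dual vector [B^-1 e_i], so Cauchy-Schwarz
    bounds it by the norm. *)
Lemma mxle_qnorm : exists2 L : R, 0 < L & forall A, mxle A (L * qnorm B A).
Proof.
pose w (i : 'I_(2 * 2)) : 'rV[R]_(2 * 2) := (invmx B *m delta_mx i (0 : 'I_1))^T.
have vi v i : v 0 i = Q v (w i).
  rewrite /Q /w trmxK mulmxA mulmxK// mxE (bigD1 i)//= mxE !eqxx mulr1 big1 ?addr0// => j ji.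
  by rewrite mxE (negbTE ji) mulr0.
exists (1 + \sum_i Num.sqrt (Q (w i) (w i))).
  by rewrite ltr_wpDr// sumr_ge0// => i _; exact: sqrtr_ge0.
move=> A i j; rewrite -(mxvecE A) vi.
set a := mxvec _; set k := mxvec_index i j.
rewrite -(sqrtr_sqr (Q a (w k))).
apply: (@le_trans _ _ (Num.sqrt (Q (w k) (w k)) * Num.sqrt (Q a a))).
  by rewrite -sqrtrM// ler_wsqrtr// mulrC posdef_Cauchy_Schwarz.
apply: ler_wpM2r; first exact: sqrtr_ge0.
rewrite (bigD1 k)//= ler_wpDl// lerDl sumr_ge0// => l _; exact: sqrtr_ge0.
Qed.

Lemma qnorm_mxle : exists2 L : R, 0 < L &
  forall A r, mxle A r -> qnorm B A <= L * r.
Proof.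
pose S := \sum_i \sum_j `|B i j|.
have S0 : 0 <= S by apply: sumr_ge0 => i _; apply: sumr_ge0.
exists (1 + S); first by rewrite ltr_wpDr.
move=> A r HA; have r0 := mxle_ge0 HA.
rewrite -[leRHS](ger0_norm (_ : 0 <= _)); last by rewrite mulr_ge0// addr_ge0.
rewrite -sqrtr_sqr; apply: ler_wsqrtr.
apply: (@le_trans _ _ (S * r ^+ 2)); last first.
  rewrite exprMn; apply: ler_wpM2r; first by rewrite exprn_ge0.
  by have := S0; nra.
have Hv i : `|mxvec A 0 i| <= r by case/mxvec_indexP: i => i j; rewrite mxvecE.
apply: le_trans (ler_norm _) _.
rewrite mxE (le_trans (ler_norm_sum _ _ _))//.
rewrite /S exchange_big /= mulr_suml; apply: ler_sum => j _.
rewrite [X in `|X * _|]mxE !mxE !mulr_suml (le_trans (ler_norm_sum _ _ _))//; apply: ler_sum => i _.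
by rewrite !normrM expr2 mulrA; apply: ler_pM => //; rewrite ?mulr_ge0// mulrC ler_pM.
Qed.

End QuadraticForm.

(** * Integral bounds for increments *)

Section IntegralBounds.
Import HBNNSimple.
Variable R : realType.
Local Notation mu := (@lebesgue_measure R).

(* Unlike [ge0_le_integral], no measurability is needed: the integral of a
   nonnegative function is a supremum over simple functions below it. *)
Lemma ge0_le_integral_sub d (T : measurableType d) (m : {measure set T -> \bar R})
  (D D' : set T) (f g : T -> \bar R) : D `<=` D' ->
  (forall x, D x -> 0 <= f x)%E -> (forall x, D' x -> 0 <= g x)%E ->
  (forall x, D x -> f x <= g x)%E ->
  (\int[m]_(x in D) f x <= \int[m]_(x in D') g x)%E.
Proof.
move=> DD f0 g0 fg; rewrite !ge0_integralE//.
apply: ereal_sup_le => _ /= [h Hh <-]; exists h => //= x.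
apply: (le_trans (Hh x)); rewrite /patch.
case: ifPn => [/set_mem xD|_]; first by rewrite (mem_set (DD _ xD)); exact: fg.
by case: ifPn => // /set_mem; exact: g0.
Qed.

Lemma le_increment_integral (F q : R -> R) (c L x : R) :
  (forall t, derivable F t 1) -> continuous (derive1 F) -> 0 < c ->
  (forall t, 0 <= t <= 1 -> 0 <= q t) ->
  (forall t, 0 <= t <= 1 -> `|derive1 F t| <= c * q t) ->
  (\int[mu]_(t in `[0%R, 1%R]) (q t)%:E <= L%:E)%E ->
  0 <= x <= 1 -> `|F x - F 0| <= c * L.
Proof.
move=> dF cF c0 q0 Fq qL /andP[x0 x1].
have L0 : 0 <= L.
  rewrite -lee_fin; apply: le_trans qL; apply: integral_ge0 => t /=.
  by rewrite in_itv/= lee_fin; exact: q0.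
have [->|xn0] := eqVneq x 0; first by rewrite subrr normr0 mulr_ge0// ltW.
have {xn0} x_gt0 : 0 < x by rewrite lt_neqAle eq_sym xn0.
have cFs : {within `[0, x], continuous (derive1 F)} by exact: continuous_subspaceT.
have cont : continuous F.
  by move=> t; apply: differentiable_continuous; apply/derivable1_diffP/dF.
have FTC : (\int[mu]_(t in `[0%R, x]) (derive1 F t)%:E = (F x)%:E - (F 0)%:E)%E.
  apply: continuous_FTC2 => //; split => //.
  - by apply: cvg_at_right_filter; exact: cont.
  - by apply: cvg_at_left_filter; exact: cont.
have mF : measurable_fun `[0, x] (derive1 F).
  by apply: (measurable_funS measurableT) => //; exact: continuous_measurable_fun.
rewrite -lee_fin (_ : (`|F x - F 0|%:E = `| \int[mu]_(t in `[0%R, x]) (derive1 F t)%:E |)%E); last first.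
  by rewrite FTC.
apply: (le_trans (le_abse_integral _ _ _)) => //; first exact/measurable_EFinP.
(* The constant is pulled out on the side of the continuous derivative, since [q] is not assumed
   measurable. *)
have -> : (\int[mu]_(t in `[0%R, x]) `|(derive1 F t)%:E| =
          \int[mu]_(t in `[0%R, x]) (c%:E * (c^-1 * `|derive1 F t|)%:E))%E.
  by apply: eq_integral => t _; rewrite -EFinM mulrA mulfV ?gt_eqF// mul1r.
have ci : 0 <= c^-1 by rewrite invr_ge0 ltW.
rewrite ge0_integralZl//; last 3 first.
- apply/measurable_EFinP; apply: measurable_funM => //.
  exact: measurableT_comp.
- by move=> t _; rewrite lee_fin mulr_ge0.
- by rewrite lee_fin ltW.
rewrite EFinM lee_pmul2l//; apply: le_trans qL.
apply: ge0_le_integral_sub => t /=; rewrite !in_itv/= ?lee_fin.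
- by move=> /andP[-> /le_trans->].
- by move=> _; rewrite mulr_ge0.
- exact: q0.
move=> /andP[t0 tx]; rewrite ler_pdivrMl//; apply: Fq.
by rewrite t0 (le_trans tx).
Qed.

End IntegralBounds.

(** * Continuously differentiable functions and matrix curves *)

Section C1Functions.
Variable R : realType.
Implicit Types (f g : R -> R).

(** The derivative is carried as data, so that the sum and product rules compute it explicitly. *)
Definition C1fun f f' := (forall t : R, is_derive t 1 f (f' t)) /\ continuous f'.

Lemma is_derive_continuous f f' : (forall t : R, is_derive t 1 f (f' t)) -> continuous f.
Proof.
move=> H t; apply: differentiable_continuous; apply/derivable1_diffP.
exact: (@ex_derive _ _ _ _ _ _ _ (H t)).
Qed.

Lemma C1fun_cst (a : R) : C1fun (fun=> a) (fun=> 0).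
Proof. by split=> t; [exact: is_derive_cst|exact: cst_continuous]. Qed.

Lemma C1fun_lin (a : R) : C1fun (fun t => t * a) (fun=> a).
Proof.
split=> t; last exact: cst_continuous.
have -> : (fun s : R => s * a) = a *: id by apply/funext => s /=; rewrite mulrC.
by apply: is_derive_eq; rewrite scaler1.
Qed.

Lemma C1funD f f' g g' : C1fun f f' -> C1fun g g' ->
  C1fun (fun t => f t + g t) (fun t => f' t + g' t).
Proof.
move=> [Hf cf] [Hg cg]; split=> t; first exact: (is_deriveD (Hf t) (Hg t)).
exact: (continuousD (cf t) (cg t)).
Qed.

Lemma C1funM f f' g g' : C1fun f f' -> C1fun g g' ->
  C1fun (fun t => f t * g t) (fun t => f' t * g t + f t * g' t).
Proof.
move=> [Hf cf] [Hg cg]; split=> t.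
  apply: (is_derive_eq (is_deriveM (Hf t) (Hg t))).
  by rewrite /GRing.scale /= addrC (mulrC (g t)).
have cf0 := is_derive_continuous Hf; have cg0 := is_derive_continuous Hg.
exact: (continuousD (continuousM (cf t) (cg0 t)) (continuousM (cf0 t) (cg t))).
Qed.

Lemma C1fun_expR (a : R) : C1fun (fun t => expR (t * a)) (fun t => expR (t * a) * a).
Proof.
have H (t : R) : is_derive t 1 (fun t => expR (t * a)) (expR (t * a) * a).
  apply: (@is_derive1_comp R expR (fun t => t * a)); exact: (C1fun_lin a).1.
split=> // t; apply: (@continuousM R R (fun t => expR (t * a)) (fun=> a)); last exact: cst_continuous.
exact: (is_derive_continuous H).
Qed.

Lemma C1fun_derive1 f f' : C1fun f f' -> derive1 f = f'.
Proof.
move=> [H _]; apply/funext => t; rewrite derive1E.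
exact: (@derive_val _ _ _ _ _ _ _ (H t)).
Qed.

Definition C1curve (c : R -> 'M[R]_2) := forall i j,
  (forall t, derivable (dcurve c i j) t 1) /\ continuous (derive1 (dcurve c i j)).

Lemma C1fun_C1curve (c c' : R -> 'M[R]_2) :
  (forall i j, C1fun (fun t => c t i j) (fun t => c' t i j)) ->
  C1curve c /\ forall t, curve_deriv c t = c' t.
Proof.
move=> H; split=> [i j|t]; last first.
  by apply/matrixP => i j; rewrite mxE (C1fun_derive1 (H i j)).
split=> [t|]; first exact: (@ex_derive _ _ _ _ _ _ _ ((H i j).1 t)).
by rewrite (C1fun_derive1 (H i j)); exact: (H i j).2.
Qed.

Lemma C1curve_C1fun c i j : C1curve c ->
  C1fun (fun t => c t i j) (fun t => curve_deriv c t i j).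
Proof.
move=> H; have [d1 d2] := H i j.
have e : (fun t => curve_deriv c t i j) = derive1 (dcurve c i j).
  by apply/funext => t; rewrite mxE.
rewrite e; split=> // t; rewrite derive1E; exact/derivableP.
Qed.

Lemma C1curve_mulr c (G : 'M[R]_2) : C1curve c ->
  C1curve (fun t => c t *m G) /\
  forall t, curve_deriv (fun s => c s *m G) t = curve_deriv c t *m G.
Proof.
move=> H; apply: (@C1fun_C1curve _ (fun t => curve_deriv c t *m G)) => i j.
have e (A : R -> 'M[R]_2) : (fun t => (A t *m G) i j) =
    (fun t => A t i 0 * G 0 j + A t i 1 * G 1 j).
  by apply/funext => t; rewrite mulmx2E.
rewrite !e (_ : (fun t => curve_deriv c t i 0 * G 0 j + _) = fun t =>
  (curve_deriv c t i 0 * G 0 j + c t i 0 * 0) +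
  (curve_deriv c t i 1 * G 1 j + c t i 1 * 0)); last first.
  by apply/funext => t; rewrite !mulr0 !addr0.
by apply: C1funD; apply: C1funM; try exact: C1fun_cst; exact: C1curve_C1fun.
Qed.

End C1Functions.

(** * Small Riemannian distance forces closeness of matrices *)

Section Distance.
Variables (R : realType) (B : 'M[R]_(2 * 2)).
Hypothesis HB : posdef B.
Implicit Types g h k : 'M[R]_2.

(* Along a curve of length [l] starting at [1], the maximal deviation [M] from [1]
   satisfies [M <= c (1 + M) l]. *)
Lemma distG_lt_near1 r : 0 < r -> exists2 s : R, 0 < s &
  forall g h, (distG B g h < s%:E)%E -> near1 r (h *m invmx g).
Proof.
move=> r0; have [L L0 HL] := mxle_qnorm HB.
(* Chosen so that [L s <= 1/16] and [L s <= r/32]. The inequality [M <= 8 (1 + M) L s] then yields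
   first [M <= 1] and next [M <= 16 L s <= r/2]. *)
pose s := Num.min (1 / 2) (r / 4) / (8 * L).
have m0 : 0 < Num.min (1 / 2) (r / 4) :> R by rewrite lt_min; apply/andP; split; lra.
have s0 : 0 < s by rewrite divr_gt0// mulr_gt0.
exists s => // g h /ereal_inf_lt[_ [c [Hc [HS [c0 c1]]] <-]] len.
have Hg : SL2 g by rewrite -c0; apply: HS; rewrite lexx ler01.
have Hh : SL2 h by rewrite -c1; apply: HS; rewrite lexx ler01.
have [Ck dk] := @C1curve_mulr R c (invmx g) Hc.
pose k t := c t *m invmx g; rewrite -/k in Ck dk.
have k0 : k 0 = 1%:M by rewrite /k c0 mulmxV// SL2_unit.
pose m t := \sum_i \sum_j `|k t i j - (1%:M : 'M[R]_2) i j|.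
have mij t i j : `|k t i j - (1%:M : 'M[R]_2) i j| <= m t.
  rewrite /m !sum_ord2; elim/ord2P: i; elim/ord2P: j;
  have := normr_ge0 (k t 0 0 - (1%:M : 'M[R]_2) 0 0);
  have := normr_ge0 (k t 0 1 - (1%:M : 'M[R]_2) 0 1);
  have := normr_ge0 (k t 1 0 - (1%:M : 'M[R]_2) 1 0);
  have := normr_ge0 (k t 1 1 - (1%:M : 'M[R]_2) 1 1); lra.
have cm : continuous m.
  have cij i j : continuous (fun t => `|k t i j - (1%:M : 'M[R]_2) i j|).
    move=> t; apply: (@continuous_comp _ _ _ (fun t => k t i j - (1%:M : 'M[R]_2) i j) Num.norm).
      apply: continuousB; last exact: cst_continuous.
      exact: (is_derive_continuous (C1curve_C1fun i j Ck).1).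
    exact: norm_continuous.
  have cD (f1 f2 : R -> R) : continuous f1 -> continuous f2 ->
      continuous (fun t => f1 t + f2 t).
    by move=> c_1 c_2 t; exact: (continuousD (c_1 t) (c_2 t)).
  have -> : m = fun t =>
    (`|k t 0 0 - (1%:M : 'M[R]_2) 0 0| + `|k t 0 1 - (1%:M : 'M[R]_2) 0 1|) +
    (`|k t 1 0 - (1%:M : 'M[R]_2) 1 0| + `|k t 1 1 - (1%:M : 'M[R]_2) 1 1|).
    by apply/funext => t; rewrite /m !sum_ord2.
  by apply: (cD _ _); apply: (cD _ _); exact: cij.
have [] := @EVT_max R m 0 1 ler01; first exact: continuous_subspaceT.
move=> T; rewrite in_itv /= => T01 mT; pose M := m T.
have M0 : 0 <= M by rewrite /M /m sumr_ge0// => i _; rewrite sumr_ge0.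
have kM t : 0 <= t <= 1 -> mxle (k t) (1 + M).
  move=> t01 i j.
  have := mT t; rewrite in_itv /= => /(_ t01) mtM.
  rewrite -(subrK ((1%:M : 'M[R]_2) i j) (k t i j)) addrC (le_trans (ler_normD _ _))// lerD//.
    exact: mxle1.
  exact: le_trans (mij _ _ _) _.
have inc i j : `|k T i j - (1%:M : 'M[R]_2) i j| <= 2 * (L * (1 + M)) * s.
  rewrite -k0; have [dk1 dk2] := Ck i j.
  apply: (@le_increment_integral R (dcurve k i j) (fun t => qnorm B (curve_deriv c t *m invmx (c t)))) => //.
  - by rewrite !mulr_gt0// ltr_wpDr.
  - by move=> t _; exact: qnorm_ge0.
  - move=> t t01; have Ht := HS _ t01.
    have -> : derive1 (dcurve k i j) t = curve_deriv k t i j by rewrite mxE.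
    rewrite dk.
    (* The derivative of [k] is the right-invariant velocity [c' c^-1], measured by the length
       integrand, times [k], whose entries are at most [1 + M]. *)
    have -> : curve_deriv c t *m invmx g = curve_deriv c t *m invmx (c t) *m k t.
      by rewrite /k -mulmxA SL2_mulKmx.
    apply: (le_trans (mxleM (HL _) (kM _ t01) i j)).
    by rewrite le_eqVlt; apply/orP; left; apply/eqP; ring.
  - exact: ltW.
have Ls : L * s = Num.min (1 / 2) (r / 4) / 8.
  by rewrite /s; field; rewrite gt_eqF.
have MLe : M <= 8 * (1 + M) * (L * s).
  rewrite /M {1}/m !sum_ord2 -/M.
  have := inc 0 0; have := inc 0 1; have := inc 1 0; have := inc 1 1; lra.
have Ls1 : L * s <= 1 / 16.
  by rewrite Ls ler_pdivrMr// ge_min; apply/orP; left; lra.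
have Ls2 : L * s <= r / 32.
  by rewrite Ls ler_pdivrMr// ge_min; apply/orP; right; lra.
have M1 : M <= 1 by nra.
have Mr : M <= r / 2 by nra.
apply: (@mxle_near1 _ (r / 2)); [|lra|].
  by apply: SL2_mul => //; exact: SL2_inv.
move=> i j; rewrite mxE [X in _ + X]mxE -c1.
apply: le_trans (mij _ _ _) _; apply: le_trans Mr; apply: mT.
by rewrite in_itv /= ler01 lexx.
Qed.

End Distance.

(** * Upper bound for the Riemannian distance near the diagonal *)

Section DistanceUpper.
Variables (R : realType) (B : 'M[R]_(2 * 2)).
Implicit Types g h k : 'M[R]_2.

(* [path s y z t] is the LDU product
   [[1,0],[tz,1]] * diag(e^(ts), e^(-ts)) * [[1,ty],[0,1]]. *)
Let path (s y z t : R) : 'M[R]_2 :=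
  mat2 (expR (t * s)) (expR (t * s) * (t * y)) (t * z * expR (t * s))
    (t * z * (expR (t * s) * (t * y)) + expR (t * - s)).

Let dpath (s y z t : R) : 'M[R]_2 :=
  mat2 (expR (t * s) * s)
    (expR (t * s) * s * (t * y) + expR (t * s) * y)
    (z * expR (t * s) + t * z * (expR (t * s) * s))
    (z * (expR (t * s) * (t * y)) +
      t * z * (expR (t * s) * s * (t * y) + expR (t * s) * y) + expR (t * - s) * - s).

Let path_C1 s y z : C1curve (path s y z) /\
  forall t, curve_deriv (path s y z) t = dpath s y z t.
Proof.
have E := @C1fun_expR R s; have F := @C1fun_expR R (- s).
have Ty := @C1fun_lin R y; have Tz := @C1fun_lin R z.
apply: C1fun_C1curve => i j.
have fE (A : R -> 'M[R]_2) f : (forall t, A t i j = f t) -> (fun t => A t i j) = f.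
  by move=> H; apply/funext.
move: i j fE; elim/ord2P; elim/ord2P => fE.
- rewrite (fE _ (fun t => expR (t * s))); last by move=> t; rewrite mat2E.
  by rewrite (fE _ (fun t => expR (t * s) * s)) // => t; rewrite mat2E.
- rewrite (fE _ _ (fun t => (mat2E _ _ _ _).1.1.2)).
  by rewrite (fE _ _ (fun t => (mat2E _ _ _ _).1.1.2)); exact: C1funM.
- rewrite (fE _ _ (fun t => (mat2E _ _ _ _).1.2)).
  by rewrite (fE _ _ (fun t => (mat2E _ _ _ _).1.2)); exact: C1funM.
- rewrite (fE _ _ (fun t => (mat2E _ _ _ _).2)).
  rewrite (fE _ _ (fun t => (mat2E _ _ _ _).2)).
  by apply: C1funD => //; apply: C1funM => //; exact: C1funM.
Qed.

Let path_SL2 s y z t : SL2 (path s y z t).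
Proof.
have e : expR (t * s) * expR (t * - s) = 1.
  by rewrite -expRD -mulrDr subrr mulr0 expR0.
apply/SL2E; rewrite /path !mat2E -e; ring.
Qed.

Let path_bounds s y z e (t : R) : e <= 1 / 2 -> `|s| <= e -> `|y| <= e -> `|z| <= e ->
  0 <= t <= 1 -> mxle (path s y z t) 3 /\ mxle (dpath s y z t) (5 * e).
Proof.
move=> e2 se ye ze /andP[t0 t1]; have e0 : 0 <= e by exact: le_trans se.
have expR2 x : `|x| <= e -> `|expR (t * x)| <= 2.
  move=> xe; rewrite ger0_norm ?expR_ge0//.
  have tx : t * x <= 1 / 2.
    by apply: (le_trans (ler_norm _)); rewrite normrM ger0_norm//; have := normr_ge0 x; nra.
  (* The upper bound for the exponential comes from the lower bound [e^(-x) >= 1 - x >= 1/2] for its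
     inverse. *)
  have h1 := expR_ge1Dx (- (t * x)).
  have h2 : expR (t * x) * expR (- (t * x)) = 1 by rewrite -expRD subrr expR0.
  have h3 := expR_ge0 (t * x).
  by nra.
have nM (x1 x2 a1 a2 : R) : `|x1| <= a1 -> `|x2| <= a2 -> `|x1 * x2| <= a1 * a2.
  by move=> h1 h2; rewrite normrM ler_pM.
have nD (x1 x2 a1 a2 : R) : `|x1| <= a1 -> `|x2| <= a2 -> `|x1 + x2| <= a1 + a2.
  by move=> h1 h2; rewrite (le_trans (ler_normD _ _))// lerD.
have le_ (x a b : R) : `|x| <= a -> a <= b -> `|x| <= b by move=> h; exact: le_trans h.
have hE := expR2 _ se; have hF : `|expR (t * - s)| <= 2 by apply: expR2; rewrite normrN.
have nt x : `|x| <= e -> `|t * x| <= e.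
  by move=> h; rewrite normrM ger0_norm//; have := normr_ge0 x; nra.
have hy := nt _ ye; have hz := nt _ ze; have hs : `|- s| <= e by rewrite normrN.
have e4 : e * e <= 1 / 4 by nra.
have e4' : e * e <= e / 2 by nra.
have e8 : e * (e * e) <= e / 4 by nra.
split; elim/ord2P; elim/ord2P; rewrite mat2E.
- by apply: (le_ _ _ _ hE); lra.
- by apply: (le_ _ _ _ (nM _ _ _ _ hE hy)); lra.
- by apply: (le_ _ _ _ (nM _ _ _ _ hz hE)); lra.
- apply: (le_ _ _ _ (nD _ _ _ _ (nM _ _ _ _ hz (nM _ _ _ _ hE hy)) hF)); lra.
- by apply: (le_ _ _ _ (nM _ _ _ _ hE se)); lra.
- by apply: (le_ _ _ _ (nD _ _ _ _ (nM _ _ _ _ (nM _ _ _ _ hE se) hy) (nM _ _ _ _ hE ye))); lra.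
- by apply: (le_ _ _ _ (nD _ _ _ _ (nM _ _ _ _ ze hE) (nM _ _ _ _ hz (nM _ _ _ _ hE se)))); lra.
- apply: (le_ _ _ _ (nD _ _ _ _ (nD _ _ _ _ (nM _ _ _ _ ze (nM _ _ _ _ hE hy)) (nM _ _ _ _ hz
   (nD _ _ _ _ (nM _ _ _ _ (nM _ _ _ _ hE se) hy) (nM _ _ _ _ hE ye)))) (nM _ _ _ _ hF hs))); lra.
Qed.

(** A matrix near 1 has its corner entry [a] near 1, hence an LDU factorisation with parameters
    [ln a], [k01 / a], [k10 / a] of size at most [2 r]. Shrinking them to 0 gives a curve from 1 to
    [k], which is then translated by [g]. *)
Lemma distG_near1_le : exists2 L : R, 0 < L &
  forall r g k, SL2 g -> r <= 1 / 4 -> near1 r k -> (distG B g (k *m g) <= (L * r)%:E)%E.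
Proof.
have [L L0 HL] := qnorm_mxle B.
(* [60 = 2 * (5 * 2) * 3]: velocity entries at most [5 * 2r], inverse entries at most 3, and a
   factor 2 for the product. *)
exists (60 * L); first by rewrite mulr_gt0.
move=> r g k Hg r4 kr; have r0 := near1_gt0 kr; have [Hk kd] := kr.
have k00 : `|k 0 0 - 1| < r by have := kd 0 0; rewrite one2E.
have k01 : `|k 0 1| < r by have := kd 0 1; rewrite one2E subr0.
have k10 : `|k 1 0| < r by have := kd 1 0; rewrite one2E subr0.
have /SL2E detk := Hk.
set a := k 0 0 in k00 detk; have /andP[a1 a2] : (- r < a - 1 < r) by rewrite -ltr_norml.
have a0 : 0 < a by lra.
have ai0 : 0 < a^-1 by rewrite invr_gt0.
have aia : a * a^-1 = 1 by rewrite mulfV// gt_eqF.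
have ai : a^-1 <= 4 / 3 by nra.
have lna : `|ln a| <= 2 * r.

  (* The inequality [ln (1 + x) <= x] is used for [a] and for [a^-1], giving both sides of the
     bound. *)
  have b1 : ln a <= a - 1 by rewrite -[X in ln X](subrK 1) addrC le_ln1Dx//; lra.
  have b2 : - ln a <= a^-1 - 1.
    by rewrite -lnV ?posrE// -[X in ln X](subrK 1) addrC le_ln1Dx//; lra.
  by rewrite ler_norml; apply/andP; split; nra.
have nd x : `|x| < r -> `|x * a^-1| <= 2 * r.
  move=> xr; rewrite normrM (gtr0_norm ai0); have := normr_ge0 x; nra.
set s := ln a in lna; set y := k 0 1 * a^-1; set z := k 1 0 * a^-1.
have [C1 dC] := path_C1 s y z.
have [C1g dCg] := C1curve_mulr g C1.
have p0 : path s y z 0 = 1%:M.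
  by apply: matrix2P; rewrite !mat2E !one2E !mul0r ?mulr0 ?expR0 ?add0r ?mul0r.
have p1 : path s y z 1 = k.
  apply: matrix2P; rewrite !mat2E !mul1r ?mulrN1 ?expRN ?lnK ?posrE//.
  - by rewrite /y mulrCA aia mulr1.
  - by rewrite /z -mulrA (mulrC a^-1) aia mulr1.
  - rewrite /y /z; apply: (mulfI (lt0r_neq0 a0)).
    have -> : a * (k 1 0 * a^-1 * (a * (k 0 1 * a^-1)) + a^-1) =
      (a * a^-1) * (a * a^-1) * (k 1 0 * k 0 1) + a * a^-1 by ring.
    by rewrite aia !mul1r; lra.
apply: (@le_trans _ _ (curve_length B (fun t => path s y z t *m g))).
  apply: ereal_inf_lbound; exists (fun t => path s y z t *m g) => //.
  split; first exact: C1g.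
  split; first by move=> t _; exact: SL2_mul.
  by rewrite p0 p1 mul1mx.
rewrite /curve_length.
apply: (@le_trans _ _ (\int[@lebesgue_measure R]_(t in `[0%R, 1%R]) (cst (60 * L * r)%:E t))%E); last first.
  rewrite integral_cst//= lebesgue_measure_itv/= lte_fin ltr01 sube0 mule1.
  exact: lexx.
apply: ge0_le_integral_sub => // t /=; rewrite in_itv/= => t01; rewrite lee_fin.
- exact: sqrtr_ge0.
- by rewrite !mulr_ge0// ltW.
rewrite dCg dC.
(* Right invariance: the translation by [g] cancels in the velocity. *)
have -> : dpath s y z t *m g *m invmx (path s y z t *m g) =
    dpath s y z t *m invmx (path s y z t).
  have e : path s y z t *m g *m (invmx g *m invmx (path s y z t)) = 1%:M.
    by rewrite -mulmxA SL2_mulVKmx// mulmxV// SL2_unit.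
  have -> : invmx (path s y z t *m g) = invmx g *m invmx (path s y z t).
    rewrite -[LHS]mulmx1 -e mulKmx//; apply: SL2_unit; exact: SL2_mul.
  by rewrite -mulmxA SL2_mulVKmx.
have [|b1 b2] := @path_bounds s y z (2 * r) t _ lna (nd _ k01) (nd _ k10) t01; first lra.
apply: (le_trans (HL _ _ (mxleM b2 (mxle_inv (path_SL2 _ _ _ _) b1)))).
by rewrite le_eqVlt; apply/orP; left; apply/eqP; ring.
Qed.

End DistanceUpper.

(** * Passage to the quotient *)

Section QuotientDistance.
Variables (R : realType) (B : 'M[R]_(2 * 2)) (Gam : set 'M[R]_2).
Hypotheses (HB : posdef B) (HGsub : is_subgroup Gam).
Implicit Types x y : Xq Gam.

Lemma distX_ge0 (x y : Xq Gam) : (0 <= distX B x y)%E.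
Proof.
apply: le_ereal_inf_tmp => _ [g [h [_ [_ ->]]]].
apply: le_ereal_inf_tmp => _ [c _ <-].
by apply: integral_ge0 => v _; rewrite lee_fin; exact: sqrtr_ge0.
Qed.

(** Some pair of representatives [g], [h] already has distance below [s], and [h g^-1] moves [x] to
    [y]. *)
Lemma distX_lt_near1 r : 0 < r -> exists2 s : R, 0 < s &
  forall x y, (distX B x y < s%:E)%E -> ball_act r x y.
Proof.
move=> /(distG_lt_near1 HB)[s s0 H]; exists s => // x y.
move=> /ereal_inf_lt[_ [g [h [/(act_ptP HGsub)[Hg ->] [/(act_ptP HGsub)[Hh ->] ->]]]]] /H kr.
exists (h *m invmx g) => //; rewrite actM//; last by eauto.
by rewrite SL2_mulmxKV.
Qed.

Lemma distX_near1_le : exists2 L : R, 0 < L &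
  forall r k x, r <= 1 / 4 -> near1 r k -> (distX B x (act k x) <= (L * r)%:E)%E.
Proof.
have [L L0 H] := distG_near1_le B; exists L => // r k x r4 kr.
have [g Hg ->] := act_transitive x.
apply: le_trans (H r g k Hg r4 kr); apply: ereal_inf_lbound.
exists g, (k *m g); split; first exact/act_ptP.
by split => //; apply/act_ptP => //; rewrite actM//; eauto; split=> //; apply: SL2_mul; eauto.
Qed.

End QuotientDistance.

(** * Measurability and the measure of small balls *)

Section Topology.
Variables (R : realType) (B : 'M[R]_(2 * 2)) (Gam : set 'M[R]_2).
Hypotheses (HB : posdef B) (HGsub : is_subgroup Gam).
Implicit Types (x y : Xq Gam) (A : set (Xq Gam)).
Local Notation x0 := (Xq_pt Gam).
Local Notation X := (XM B Gam).

(** The two distance comparisons show that metric balls and the sets [ball_act] define the same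
    topology; all measurability questions are settled with the latter. *)
Lemma openX_ballP A :
  openX B A <-> forall x, A x -> exists2 r : R, 0 < r & ball_act r x `<=` A.
Proof.
split=> H x Ax; last first.
  have [r r0 rA] := H x Ax; have [s s0 Hs] := distX_lt_near1 HB HGsub r0.
  by exists s; split=> // y /Hs /rA.
have [r [r0 rA]] := H x Ax; have [L L0 HL] := distX_near1_le B HGsub.
exists (Num.min (1 / 4) (r / (2 * L))).
  by rewrite lt_min divr_gt0//= divr_gt0// mulr_gt0.
move=> _ [k kr <-]; apply: rA => /=.
apply: (le_lt_trans (HL _ k x _ kr)); first by rewrite ge_min lexx.
rewrite lte_fin; apply: (@le_lt_trans _ _ (r / 2)); last lra.
have -> : r / 2 = L * (r / (2 * L)) by field; rewrite gt_eqF.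
by rewrite ler_pM2l// ge_min lexx orbT.
Qed.

Lemma openX_measurable A : openX B A -> measurable (A : set X).
Proof. by move=> H; exact: sub_sigma_algebra. Qed.

Definition orbit_set (P : set 'M[R]_2) x : set (Xq Gam) :=
  [set act g x | g in [set g | SL2 g /\ P g]].

Lemma openX_orbit_set (P : set 'M[R]_2) x :
  (forall g, P g -> exists2 e : R, 0 < e & forall h, mxle (h - g) e -> P h) ->
  openX B (orbit_set P x).
Proof.
move=> HP; apply/openX_ballP => _ [g [Hg Pg] <-].
have [e e0 He] := HP g Pg; have [n gn] := mxle_exists g.
have n0 : 0 < (n.+1%:R : R) by rewrite ltr0n.
exists (e / (2 * n.+1%:R)); first by rewrite divr_gt0// mulr_gt0.
move=> _ [k kr <-]; exists (k *m g); last by rewrite actM//; eauto.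
split; first by apply: SL2_mul; eauto.
apply: He; rewrite -{2}(mul1mx g) -mulmxBl.
have gK : mxle g n.+1%:R by apply: mxleW gn; rewrite ler_nat leqnSn.
apply: mxleW (mxleM (near1_mxle kr) gK).
by rewrite le_eqVlt; apply/orP; left; apply/eqP; field; rewrite addrC natr1 gt_eqF.
Qed.

Lemma ball_act_orbit_set r x : ball_act r x =
  orbit_set (fun k => forall i j, `|k i j - (1%:M : 'M[R]_2) i j| < r) x.
Proof. by []. Qed.

Lemma openX_ball_act r x : openX B (ball_act r x).
Proof.
rewrite ball_act_orbit_set; apply: openX_orbit_set => g Pg.
pose e := Num.min (Num.min (r - `|g 0 0 - (1%:M : 'M[R]_2) 0 0|) (r - `|g 0 1 - (1%:M : 'M[R]_2) 0 1|))
 (Num.min (r - `|g 1 0 - (1%:M : 'M[R]_2) 1 0|) (r - `|g 1 1 - (1%:M : 'M[R]_2) 1 1|)).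
have e0 : 0 < e by rewrite /e !lt_min !subr_gt0 !Pg.
have ee i j : e <= r - `|g i j - (1%:M : 'M[R]_2) i j|.
  by rewrite /e; elim/ord2P: i; elim/ord2P: j; rewrite !ge_min lexx ?orbT.
exists (e / 2); first lra.
move=> h hg i j; have h1 := ee i j; have h2 : `|h i j - g i j| <= e / 2 by have := hg i j; rewrite !mxE.
have := ler_normD (h i j - g i j) (g i j - (1%:M : 'M[R]_2) i j).
by rewrite addrA subrK; lra.
Qed.

Lemma measurable_ball_act r x : measurable (ball_act r x : set X).
Proof. by apply: openX_measurable; exact: openX_ball_act. Qed.

Lemma ball_act_act r K g x : SL2 g -> 0 < K -> mxle g K ->
  [set act g y | y in ball_act r x] `<=` ball_act (8 * K ^+ 2 * r) (act g x).
Proof.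
move=> Hg K0 gK _ [_ [k kr <-] <-]; exists (g *m k *m invmx g).
  exact: near1_conj.
have Hk := near1_SL2 kr.
by rewrite !actM// ?SL2_mulmxKV//; do ?apply: SL2_mul => //; exact: SL2_inv.
Qed.

Lemma measurable_act g : SL2 g -> measurable_fun setT (act g : X -> X).
Proof.
move=> Hg; apply: (@measurability _ _ X X setT (act g) (@openX R B Gam) erefl).
move=> _ [A oA <-]; rewrite setTI; apply: openX_measurable.
move/openX_ballP : oA => oA; apply/openX_ballP => x /= /oA[r r0 rA].
have [n gn] := mxle_exists g; have K0 : 0 < (n.+1%:R : R) by rewrite ltr0n.
have gK : mxle g n.+1%:R by apply: mxleW gn; rewrite ler_nat leqnSn.
have c0 : 0 < 8 * n.+1%:R ^+ 2 :> R by rewrite mulr_gt0// exprn_gt0.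
exists (r / (8 * n.+1%:R ^+ 2)); first by rewrite divr_gt0.
move=> y yb; apply: rA.
have := @ball_act_act (r / (8 * n.+1%:R ^+ 2)) _ g x Hg K0 gK (act g y).
have -> : 8 * n.+1%:R ^+ 2 * (r / (8 * n.+1%:R ^+ 2)) = r by rewrite mulrC divfK ?gt_eqF.
by apply; exists y.
Qed.

(** Superlevel sets of [f] are open. The constant [|K| + 1] replaces [K], whose sign is unknown. *)
Lemma measurable_Lipschitz (f : X -> R) (K : R) :
  (forall x y, (`|f x - f y|%:E <= K%:E * distX B x y)%E) ->
  measurable_fun setT f.
Proof.
move=> fK; have [L L0 HL] := distX_near1_le B HGsub.
apply: (measurability (@RGenOInfty.G R)); first exact: RGenOInfty.measurableE.
move=> _ [_ [t ->] <-]; rewrite setTI; apply: openX_measurable.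
apply/openX_ballP => x /=; rewrite in_itv/= andbT => tx.
pose C := 2 * ((`|K| + 1) * L).
have C0 : 0 < C by rewrite !mulr_gt0// ltr_wpDl.
exists (Num.min (1 / 4) ((f x - t) / C)).
  by rewrite lt_min divr_gt0//= divr_gt0// subr_gt0.
move=> _ [k kr <-] /=; rewrite in_itv/= andbT.
set s := Num.min _ _ in kr; have s0 := near1_gt0 kr.
have s4 : s <= 1 / 4 by rewrite ge_min lexx.
have sC : s <= (f x - t) / C by rewrite ge_min lexx orbT.
have dle := HL s k x s4 kr.
have d0 := distX_ge0 B x (act k x).
have : (`|f x - f (act k x)|%:E <= ((`|K| + 1) * (L * s))%:E)%E.
  apply: (le_trans (fK _ _)); rewrite EFinM.
  apply: (@le_trans _ _ ((`|K| + 1)%:E * distX B x (act k x))%E).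
    by apply: lee_wpmul2r => //; rewrite lee_fin (le_trans (ler_norm _))// lerDl.
  by apply: lee_wpmul2l => //; rewrite lee_fin addr_ge0.
rewrite lee_fin => h.
have : (`|K| + 1) * (L * s) <= (f x - t) / 2.
  move: sC; rewrite ler_pdivlMr// /C; lra.
have := ler_norm (f x - f (act k x)); lra.
Qed.

End Topology.

(** * Finite nets in bounded pieces of the group *)

Section SL2Covering.
Variable R : realType.
Implicit Types (g h : 'M[R]_2) (K : R).

(* On a chart the entry [g 1 1] is determined by the three others. *)
Definition chart K g := K^-1 < `|g 0 0| /\
  [/\ `|g 0 0| < K, `|g 0 1| < K & `|g 1 0| < K].

(** Left multiplication by this matrix moves the second row to the top. When [g 0 0 = 0] the
    determinant makes [g 1 0] nonzero, so the translate lies in a chart. *)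
Definition weyl : 'M[R]_2 := mat2 0 1 (-1) 0.

Lemma SL2_weyl : SL2 weyl.
Proof. by apply/SL2E; rewrite !mat2E; ring. Qed.

Lemma chart_cover g : SL2 g -> exists n : nat,
  chart n.+1%:R g \/ chart n.+1%:R (weyl *m g).
Proof.
move=> /SL2E dg.
have H (a b c : R) : a != 0 -> exists n : nat, n.+1%:R^-1 < `|a| /\
    [/\ `|a| < n.+1%:R, `|b| < n.+1%:R & `|c| < n.+1%:R].
  move=> a0; pose t : R := `|a| + `|b| + `|c| + `|a|^-1.
  have ha : 0 < `|a| by rewrite normr_gt0.
  have hb := normr_ge0 b; have hc := normr_ge0 c.
  have hai : 0 < `|a|^-1 by rewrite invr_gt0.
  have t0 : 0 <= t by rewrite /t; lra.
  exists (Num.bound t); have h := archi_boundP t0.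
  have hs : t < (Num.bound t).+1%:R by apply: lt_le_trans h _; rewrite ler_nat.
  split; last by split; apply: le_lt_trans hs; rewrite /t; lra.
  rewrite -[ltRHS]invrK ltf_pV2 ?posrE//; apply: le_lt_trans hs; rewrite /t; lra.
have [a0|a0] := eqVneq (g 0 0) 0; last first.
  by have [n Hn] := H _ (g 0 1) (g 1 0) a0; exists n; left.
have c0 : g 1 0 != 0.
  by apply/negP => /eqP c0; move: dg; rewrite a0 c0 mul0r mulr0 subrr => /eqP; rewrite eq_sym oner_eq0.
have [n [Hn1 [Hn2 Hn3 Hn4]]] := H _ (g 1 1) (g 0 0) c0.
exists n; right; rewrite /chart !mulmx2E !mat2E !mul0r !mul1r !add0r addr0 mulN1r normrN.
by split.
Qed.

Lemma chart_open K g : 0 < K -> chart K g ->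
  exists2 e : R, 0 < e & forall h, mxle (h - g) e -> chart K h.
Proof.
move=> K0 [g1 [g2 g3 g4]].
pose e := Num.min (Num.min (`|g 0 0| - K^-1) (K - `|g 0 0|))
  (Num.min (K - `|g 0 1|) (K - `|g 1 0|)).
have e0 : 0 < e by rewrite /e !lt_min !subr_gt0 g1 g2 g3 g4.
exists (e / 2); first lra.
move=> h hg.
have e1 : e <= `|g 0 0| - K^-1 by rewrite /e !ge_min lexx.
have e2 : e <= K - `|g 0 0| by rewrite /e !ge_min lexx ?orbT.
have e3 : e <= K - `|g 0 1| by rewrite /e !ge_min lexx ?orbT.
have e4 : e <= K - `|g 1 0| by rewrite /e !ge_min lexx ?orbT.
have hd i j : `|h i j| <= `|g i j| + e / 2 /\ `|g i j| <= `|h i j| + e / 2.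
  have := hg i j; rewrite !mxE => H; split.
    by have := ler_normD (h i j - g i j) (g i j); rewrite subrK; lra.
  by have := ler_normB (h i j) (h i j - g i j); rewrite opprB addrC subrK; lra.
have [h1 h1'] := hd 0 0; have [h2 _] := hd 0 1; have [h3 _] := hd 1 0.
by split; [lra|split; lra].
Qed.

Lemma chart_entry K g : 1 <= K -> SL2 g -> chart K g -> mxle g (2 * K ^+ 3).
Proof.
move=> K1 /SL2E dg [g1 [g2 g3 g4]].
have K0 : 0 < K by lra.
have Ki : K * K^-1 = 1 by rewrite mulfV// gt_eqF.
have g1' : 1 < K * `|g 0 0| by rewrite -Ki ltr_pM2l.
have K3 : K <= K ^+ 3 by rewrite ler_eXnr.
have bc : `|g 0 1 * g 1 0| <= K * K by rewrite normrM ler_pM// ltW.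
have ad : `|g 0 0 * g 1 1| <= 1 + K * K.
  have -> : g 0 0 * g 1 1 = 1 + g 0 1 * g 1 0 by lra.
  by apply: le_trans (ler_normD _ _) _; rewrite normr1; lra.
have d1 : `|g 1 1| <= K * (1 + K * K).
  apply: (@le_trans _ _ (K * (`|g 0 0| * `|g 1 1|))); last by rewrite ler_pM2l// -normrM.
  by rewrite mulrA ler_peMl// ltW.
elim/ord2P; elim/ord2P; [lra|lra|lra|].
by apply: le_trans d1 _; rewrite !exprS expr0 mulr1 in K3 *; lra.
Qed.

(** Subtracting the two determinant equations expresses [g00 (g11 - h11)] through the other three
    differences; dividing by [g00], which exceeds [1/K] in absolute value, controls the last entry.
    Then [h^-1 g - 1 = h^-1 (g - h)]. *)
Lemma chart_close K s g h : 1 <= K -> SL2 g -> SL2 h -> chart K g -> chart K h ->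
  `|g 0 0 - h 0 0| <= s -> `|g 0 1 - h 0 1| <= s -> `|g 1 0 - h 1 0| <= s ->
  mxle (invmx h *m g - 1%:M) (16 * K ^+ 7 * s).
Proof.
move=> K1 Hg Hh Cg Ch sa sb sc.
have s0 : 0 <= s by apply: le_trans sa.
have K0 : 0 < K by lra.
have Kh := chart_entry K1 Hh Ch.
have Kp m n : (m <= n)%N -> K ^+ m <= K ^+ n by move=> mn; exact: ler_weXn2l.
have sd : `|g 1 1 - h 1 1| <= 4 * K ^+ 4 * s.
  have [g1 [g2 g3 g4]] := Cg; have [h1 [h2 h3 h4]] := Ch.
  have Ki : K * K^-1 = 1 by rewrite mulfV// gt_eqF.
  have g1' : 1 <= K * `|g 0 0| by rewrite -Ki ler_pM2l// ltW.
  apply: (@le_trans _ _ (K * (`|g 0 0| * `|g 1 1 - h 1 1|))).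
    by rewrite mulrA ler_peMl.
  rewrite -normrM.
  have -> : g 0 0 * (g 1 1 - h 1 1) =
    g 0 1 * (g 1 0 - h 1 0) + h 1 0 * (g 0 1 - h 0 1) - h 1 1 * (g 0 0 - h 0 0).
    have /SL2E := Hg; have /SL2E := Hh; lra.
  have -> : 4 * K ^+ 4 * s = K * (K ^+ 3 * s + K ^+ 3 * s + 2 * K ^+ 3 * s) by ring.
  rewrite ler_pM2l//; apply: (le_trans (ler_normB _ _)); apply: lerD; last first.
    by rewrite normrM ler_pM.
  have K3 : K <= K ^+ 3 by rewrite ler_eXnr.
  apply: (le_trans (ler_normD _ _)); apply: lerD; rewrite normrM ler_pM//.
    exact: le_trans (ltW g3) K3.
  exact: le_trans (ltW h4) K3.
have -> : invmx h *m g - 1%:M = invmx h *m (g - h).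
  by rewrite mulmxBr mulVmx// SL2_unit.
have -> : 16 * K ^+ 7 * s = 2 * (2 * K ^+ 3 * (4 * K ^+ 4 * s)) by ring.
apply: mxleM; first exact: mxle_inv.
have sK : s <= 4 * K ^+ 4 * s.
  apply: ler_peMl => //; have := Kp 0%N 4%N isT; rewrite expr0; lra.
by elim/ord2P; elim/ord2P; rewrite !mxE//; apply: le_trans sK.
Qed.

(** The three free entries range over a cube of side [2K], cut into [n^3] boxes. Two chart matrices
    in one box have these entries within [2K / n] of each other, so [chart_close] gives
    [32 K^8 / n]; the constant is doubled for strictness. *)
Lemma chart_net K : 1 <= K -> exists2 c : R, 0 < c & forall n : nat, (0 < n)%N ->
  exists l : seq 'M[R]_2, [/\ size l = (n ^ 3)%N, (forall h, h \in l -> SL2 h) &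
    forall g, SL2 g -> chart K g ->
      exists2 h, h \in l & near1 (c / n%:R) (invmx h *m g)].
Proof.
move=> K1; have K0 : 0 < K by lra.
exists (64 * K ^+ 8); first by rewrite mulr_gt0// exprn_gt0.
move=> n n0; have n0R : 0 < (n%:R : R) by rewrite ltr0n.
pose idx (x : R) : nat := Num.trunc (n%:R * ((x + K) / (2 * K))).
pose P (q : 'I_n * 'I_n * 'I_n) : set 'M[R]_2 := [set h | SL2 h /\ chart K h /\
  [/\ idx (h 0 0) = q.1.1, idx (h 0 1) = q.1.2 & idx (h 1 0) = q.2]].
(* Boxes that meet no chart matrix receive the identity; they are never consulted, but keep the list
   at length exactly [n^3]. *)
pose rep q := if pselect (exists h, P q h) is left H then projT1 (cid H) else 1%:M.
have repP q h : P q h -> P q (rep q).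
  by move=> Hh; rewrite /rep; case: pselect => [H|[]]; [case: cid|exists h].
have repSL2 q : SL2 (rep q).
  by rewrite /rep; case: pselect => [H|_]; [case: cid => h []|exact: SL2_1].
exists [seq rep q | q <- enum {: 'I_n * 'I_n * 'I_n}]; split.
- by rewrite size_map -cardE !card_prod card_ord !expnS expn0 muln1 mulnA.
- by move=> h /mapP[q _ ->].
move=> g Hg Cg; have [_ [g2 g3 g4]] := Cg.
have ub (x : R) : `|x| < K -> 0 <= n%:R * ((x + K) / (2 * K)) < n%:R.
  rewrite ltr_norml => /andP[x1 x2]; apply/andP; split.
    by rewrite mulr_ge0// ?divr_ge0//; lra.
  by rewrite gtr_pMr// ltr_pdivrMr//; lra.
have idx_lt (x : R) : `|x| < K -> (idx x < n)%N.
  move=> /ub/andP[x1 x2]; rewrite -(ltr_nat R); apply: le_lt_trans x2.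
  by rewrite truncn_le.
have idx_close (x y : R) : `|x| < K -> `|y| < K -> idx x = idx y ->
    `|x - y| <= 2 * K / n%:R.
  move=> /ub/andP[x1 x2] /ub/andP[y1 y2] e.
  have /andP[xa xb] := truncn_itv x1; have /andP[ya yb] := truncn_itv y1.
  rewrite -/(idx x) in xa xb; rewrite -/(idx y) -e in ya yb.
  rewrite ler_pdivlMr// -[X in _ * X]ger0_norm; last exact: ltW.
  rewrite -normrM.
  have -> : (x - y) * n%:R = (n%:R * ((x + K) / (2 * K)) - n%:R * ((y + K) / (2 * K))) * (2 * K).
    by field; rewrite gt_eqF.
  rewrite normrM (@ger0_norm _ (2 * K)) ?ger_pMl//; try lra.
  rewrite -[(idx x).+1%:R]natr1 in xb yb; rewrite ler_norml; apply/andP; split; lra.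
pose q := (Ordinal (idx_lt _ g2), Ordinal (idx_lt _ g3), Ordinal (idx_lt _ g4)).
have [Hr [Cr [r1 r2 r3]]] := repP q g (conj Hg (conj Cg (And3 erefl erefl erefl))).
have [_ [c2 c3 c4]] := Cr.
exists (rep q); first by apply/mapP; exists q => //; rewrite mem_enum.
apply: (@mxle_near1 _ (16 * K ^+ 7 * (2 * K / n%:R))).
- by apply: SL2_mul => //; exact: SL2_inv.
- have -> : 16 * K ^+ 7 * (2 * K / n%:R) = (32 * K ^+ 8) / n%:R by rewrite mulrA; congr (_ / _); ring.
  rewrite ltr_pM2r ?invr_gt0//.
  by have : 0 < K ^+ 8 by [rewrite exprn_gt0]; lra.
by apply: chart_close => //; apply: idx_close.
Qed.

End SL2Covering.

(** * Lower bounds for the measure of balls *)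

Section BallMeasure.
Variables (R : realType) (B : 'M[R]_(2 * 2)) (Gam : set 'M[R]_2).
Hypotheses (HB : posdef B) (HGsub : is_subgroup Gam).
Variable mu : probability (XM B Gam) R.
Hypothesis Hinv : forall g, SL2 g -> forall A : set (XM B Gam), measurable A ->
  mu (act g @^-1` A) = mu A.
Local Notation x0 := (Xq_pt Gam).
Local Notation X := (XM B Gam).

Lemma measure_le_cover_seq (I : eqType) (l : seq I) (F : I -> set X) (A : set X) (v : \bar R) :
  measurable A -> (forall i, i \in l -> measurable (F i)) ->
  (forall i, i \in l -> (mu (F i) <= v)%E) ->
  (forall x, A x -> exists2 i, i \in l & F i x) ->
  (mu A <= (size l)%:R%:E * v)%E.
Proof.
move=> mA mF Fv AF.
pose U s : set X := foldr (fun i V => F i `|` V) set0 s.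
have UP s x i : i \in s -> F i x -> U s x.
  elim: s => //= j s IH; rewrite in_cons => /orP[/eqP->|/IH H] Fx; [by left|].
  by right; exact: H.
suff [mU Uv] : measurable (U l) /\ (mu (U l) <= (size l)%:R%:E * v)%E.
  apply: le_trans Uv; apply: le_measure; rewrite ?inE// => x /AF[i il Fx].
  exact: UP Fx.
elim: l mF Fv {AF} => [|i l IH] mF Fv /=.
  by split; [exact: measurable0|rewrite measure0 mul0e].
have [|j jl|mU Uv] := IH; first by move=> j jl; apply: mF; rewrite in_cons jl orbT.
  by apply: Fv; rewrite in_cons jl orbT.
have mi : measurable (F i) by apply: mF; rewrite mem_head.
split; first exact: measurableU.
have v0 : (0 <= v)%E by apply: le_trans (Fv i (mem_head _ _)).
apply: (le_trans (measureU2 _ mi mU)).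
rewrite -[(size l).+1%:R]natr1 EFinD ge0_muleDl ?lee_fin ?ler0n//.
by rewrite mul1e addeC leeD// Fv// mem_head.
Qed.

(** Countably many charts and their preimages under [weyl] exhaust the space. By invariance all
    would be null if every chart were, contradicting total mass 1. *)
Lemma measure_chart_pos : exists2 n : nat,
  measurable (orbit_set (chart n.+1%:R) x0 : set X) &
  (0 < mu (orbit_set (chart n.+1%:R) x0 : set X))%E.
Proof.
have mD (n : nat) : measurable (orbit_set (chart n.+1%:R) x0 : set X).
  apply: openX_measurable; apply: openX_orbit_set => // g Cg. by apply: chart_open Cg; rewrite ltr0n.
apply: contrapT => H.
have D0 (n : nat) : mu (orbit_set (chart n.+1%:R) x0 : set X) = 0%E.
  apply/eqP; rewrite eq_le measure_ge0 andbT leNgt; apply/negP => ?.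
  by apply: H; exists n.
pose W := weyl R; have HW : SL2 W := SL2_weyl R.
pose F (n : nat) : set X := orbit_set (chart n.+1%:R) x0 `|`
  act W @^-1` (orbit_set (chart n.+1%:R) x0 : set X).
have mW (n : nat) : measurable (act W @^-1` (orbit_set (chart n.+1%:R) x0 : set X) : set X).
  by rewrite -[X in measurable X]setTI; exact: (measurable_act HB HGsub HW).
have mF n : measurable (F n) by exact: measurableU.
have F0 n : mu (F n) = 0%E.
  apply/eqP; rewrite eq_le measure_ge0 andbT.
  apply: (le_trans (measureU2 _ (mD n) (mW n))).
  rewrite -[leRHS]adde0; apply: leeD; rewrite le_eqVlt; apply/orP; left; apply/eqP.
    exact: D0.
  by apply: etrans (D0 n); apply: Hinv.
have : (mu setT <= \sum_(0 <= n <oo) mu (F n))%E.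
  apply: measure_sigma_subadditive => // x _.
  have [g Hg ->] := act_transitive x; have [n [Cn|Cn]] := chart_cover Hg; exists n => //.
    by left; exists g.
  right; exists (W *m g); first by split => //; exact: SL2_mul.
  by rewrite actM.
rewrite eseries0//.
by rewrite probability_setT lee_fin ler10.
Qed.

(* Each translate [h (ball_act r x0)] has the measure of [ball_act r x0] by
   invariance, and [O(r^-3)] of them cover a set of positive measure. *)
Lemma ball_act_pt_measure : exists2 m0 : R, 0 < m0 & exists2 r0 : R, 0 < r0 &
  forall r, 0 < r -> r <= r0 -> ((m0 * r ^+ 3)%:E <= mu (ball_act r x0 : set X))%E.
Proof.
have [N mD Dpos] := measure_chart_pos.
have [|c c0 Hc] := @chart_net R N.+1%:R; first by rewrite ler1n.
set D := orbit_set _ _ in mD Dpos.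
have Dfin : mu D \is a fin_num by exact: fin_num_measure.
pose m := fine (mu D); have mE : mu D = m%:E by rewrite fineK.
have m_gt0 : 0 < m by rewrite -lte_fin -mE.
exists (m / (2 * c) ^+ 3); first by rewrite divr_gt0// exprn_gt0// mulr_gt0.
(* For [r <= c] the quotient [c / r] is at least 1, so the integer [n] just above it satisfies both
   [c / n <= r] and [n <= 2 c / r]. *)
exists c => // r r_gt0 rc.
pose n := (Num.trunc (c / r)).+1.
have cr1 : 1 <= c / r by rewrite ler_pdivlMr// mul1r.
have cr0 : 0 <= c / r by lra.
have /andP[n1 n2] := truncn_itv cr0; rewrite -/n in n2.
have nR : (n%:R : R) <= 2 * c / r by rewrite /n -[_.+1%:R]natr1 -mulrA; lra.
have n0R : 0 < (n%:R : R) by rewrite ltr0n.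
have cnr : c / n%:R <= r.
  by rewrite ler_pdivrMr// mulrC -ler_pdivrMr// ltW.
have [l [sl lSL2 lcov]] := Hc n isT.
have mb := @measurable_ball_act R B Gam HB HGsub.
have : (mu D <= (size l)%:R%:E * mu (ball_act r x0 : set X))%E.
  apply: (@measure_le_cover_seq _ l (fun h => act (invmx h) @^-1` (ball_act r x0 : set X))) => //.
  - move=> h /lSL2 Hh; rewrite -[X in measurable X]setTI.
    by apply: (measurable_act HB HGsub (SL2_inv Hh)).
  - by move=> h /lSL2 Hh; rewrite (Hinv (SL2_inv Hh) (mb _ _)).
  - move=> _ [g [Hg Cg] <-]; have [h hl hn] := lcov g Hg Cg; exists h => //.
    exists (invmx h *m g); first exact: near1W hn.
    by rewrite actM//; exact/SL2_inv/lSL2.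
have wfin : mu (ball_act r x0 : set X) \is a fin_num by apply: fin_num_measure; exact: mb.
rewrite -(fineK wfin) mE -EFinM !lee_fin sl natrX.
set w := fine _ => mw.
have w0 : 0 <= w by rewrite fine_ge0.
have h : m <= (2 * c / r) ^+ 3 * w.
  apply: le_trans mw _; apply: ler_wpM2r => //.
  by rewrite lerXn2r ?nnegrE ?ler0n// (le_trans _ nR)// ler0n.
rewrite mulrAC ler_pdivrMr ?exprn_gt0 ?mulr_gt0// mulrC -ler_pdivlMl ?exprn_gt0//.
by apply: le_trans h _; rewrite le_eqVlt; apply/orP; left; apply/eqP; field; rewrite gt_eqF.
Qed.

(** Multiplication by [g] carries the ball of radius [r / (8 K^2)] at the base point into the ball
    of radius [r] at its image, so invariance transports the previous bound. *)
Lemma ball_act_measure : exists2 m0 : R, 0 < m0 & exists2 r0 : R, 0 < r0 &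
  forall r K g, 0 < r -> r <= r0 -> 1 <= K -> SL2 g -> mxle g K ->
  ((m0 * (r / (8 * K ^+ 2)) ^+ 3)%:E <= mu (ball_act r (act g x0) : set X))%E.
Proof.
have [m0 m00 [r0 r00 H]] := ball_act_pt_measure; exists m0 => //; exists r0 => //.
move=> r K g r_gt0 rr0 K1 Hg gK.
have K0 : 0 < K by lra.
have c1 : 1 <= 8 * K ^+ 2.
  by have : 1 <= K ^+ 2 by [rewrite exprn_ege1]; lra.
have c0 : 0 < 8 * K ^+ 2 by lra.
have mb := @measurable_ball_act R B Gam HB HGsub.
apply: le_trans (H (r / (8 * K ^+ 2)) _ _) _.
- by rewrite divr_gt0.
- by apply: le_trans rr0; rewrite ler_pdivrMr// ler_peMr// ltW.
rewrite -[leRHS](Hinv Hg); last exact: mb.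
apply: le_measure; rewrite ?inE; [exact: mb| |].
  by rewrite -[X in measurable X]setTI; apply: (measurable_act HB HGsub Hg).
move=> y yb /=; have := @ball_act_act R Gam (r / (8 * K ^+ 2)) K g x0 Hg K0 gK (act g y).
have -> : 8 * K ^+ 2 * (r / (8 * K ^+ 2)) = r by rewrite mulrC divfK// gt_eqF.
by apply; exists y.
Qed.

End BallMeasure.

(** * Second moments of ergodic sums *)

Section SecondMoment.
Variables (d : measure_display) (T : measurableType d) (R : realType).
Variable P : probability T R.

Lemma integrable_bounded (f : T -> R) (M : R) : measurable_fun setT f ->
  (forall x, `|f x| <= M) -> P.-integrable setT (EFin \o f).
Proof.
move=> mf fM; apply: measurable_bounded_integrable => //.
  by rewrite (le_lt_trans (probability_le1 P measurableT)) ?ltry.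
exists M; split; first exact: num_real.
by move=> t Mt x _; apply: le_trans (fM x) (ltW Mt).
Qed.

Lemma integral_bounded_le (f : T -> R) (M : R) : measurable_fun setT f ->
  (forall x, `|f x| <= M) -> (`| \int[P]_x (f x)%:E | <= M%:E)%E.
Proof.
move=> mf fM; apply: (le_trans (le_abse_integral _ _ _)) => //; first exact/measurable_EFinP.
apply: (@le_trans _ _ (\int[P]_x (cst M%:E x))%E).
  by apply: ge0_le_integral_sub => // x _ /=; rewrite lee_fin// (le_trans _ (fM x)).
by rewrite integral_cst//= probability_setT mule1.
Qed.

Lemma second_moment_le (I : eqType) (l : seq I) (F : I -> T -> R) (M : R) (c : I -> I -> R) :
  (forall i, measurable_fun setT (F i)) -> (forall i x, `|F i x| <= M) ->
  (forall i j, i \in l -> j \in l -> (`| \int[P]_x (F i x * F j x)%:E | <= (c i j)%:E)%E) ->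
  (\int[P]_x ((\sum_(i <- l) F i x) ^+ 2)%:E <= (\sum_(i <- l) \sum_(j <- l) c i j)%:E)%E.
Proof.
move=> mF FM Hc.
have iFF i j : P.-integrable setT (fun x => (F i x * F j x)%:E).
  apply: (@integrable_bounded (fun x => F i x * F j x) (M * M)).
    exact: measurable_funM.
  by move=> x; rewrite normrM ler_pM.
have -> : (\int[P]_x ((\sum_(i <- l) F i x) ^+ 2)%:E =
    \int[P]_x (\sum_(i <- l) \sum_(j <- l) (F i x * F j x)%:E))%E.
  apply: eq_integral => x _; rewrite expr2 mulr_suml -sumEFin; apply: eq_bigr => i _.
  by rewrite mulr_sumr -sumEFin.
rewrite integral_sum//; last by move=> i; exact: integrable_sum.
rewrite -sumEFin; rewrite big_seq [leRHS]big_seq; apply: lee_sum => i il.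
rewrite integral_sum//.
rewrite -sumEFin; rewrite big_seq [leRHS]big_seq; apply: lee_sum => j jl.
exact: le_trans (lee_abs _) (Hc i j il jl).
Qed.

Lemma Markov_sqr (S : T -> R) (e q : R) : measurable_fun setT S -> 0 < e ->
  (\int[P]_x (S x ^+ 2)%:E <= q%:E)%E ->
  (P [set x | (e < `|S x|)%R] <= (e ^- 2 * q)%:E)%E.
Proof.
move=> mS e0 Sq.
have mE : measurable [set x | e < `|S x|].
  have -> : [set x | e < `|S x|] = (fun x => `|S x|) @^-1` `]e, +oo[.
    by apply/seteqP; split=> x /=; rewrite in_itv/= andbT.
  have mN : measurable_fun setT (fun x => `|S x|) by exact: measurableT_comp.
  by rewrite -[X in measurable X]setTI; exact: mN.
have e2 : 0 < e ^+ 2 by rewrite exprn_gt0.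
have : ((e ^+ 2)%:E * P [set x | (e < `|S x|)%R] <= q%:E)%E.
  apply: le_trans Sq; rewrite -(integral_cst P mE (e ^+ 2)%:E).
  apply: ge0_le_integral_sub => //.
  - by move=> x _; rewrite lee_fin ltW.
  - by move=> x _; rewrite lee_fin sqr_ge0.
  - move=> x /= ex; rewrite lee_fin -(real_normK (num_real (S x))).
    by rewrite lerXn2r// ?nnegrE ltW.
have Pf : P [set x | (e < `|S x|)%R] \is a fin_num by exact: fin_num_measure.
rewrite -(fineK Pf) -EFinM !lee_fin => h.
by rewrite mulrC ler_pdivlMr// mulrC.
Qed.

End SecondMoment.

(** * Counting pairs of nearby indices *)

Section Counting.
Variable R : realType.

Lemma count_close (i T N : nat) :
  (count (fun j => (i < j + T)%N && (j < i + T)%N) (index_iota 1 N.+1) <= 2 * T)%N.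
Proof.
rewrite -size_filter -[leqRHS](size_iota (i - T)); apply: uniq_leq_size.
  by rewrite filter_uniq// iota_uniq.
move=> j; rewrite mem_filter mem_iota => /andP[/andP[h1 h2] _]; lia.
Qed.

Lemma sum_if_le (I : Type) (l : seq I) (b : pred I) (p q : R) : 0 <= p -> 0 <= q ->
  \sum_(j <- l) (if b j then p else q) <= (count b l)%:R * p + (size l)%:R * q.
Proof.
move=> p0 q0; elim: l => [|i l IH]; first by rewrite big_nil !mul0r addr0.
rewrite big_cons /= -[(size l).+1%:R]natr1 natrD.
by case: (b i); rewrite /= ?mulr1n ?mulr0n; lra.
Qed.

Lemma sum_close_far (N T : nat) (p q : R) : 0 <= p -> 0 <= q ->
  \sum_(i <- index_iota 1 N.+1) \sum_(j <- index_iota 1 N.+1)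
    (if (i < j + T)%N && (j < i + T)%N then p else q) <=
  N%:R * ((2 * T)%:R * p + N%:R * q).
Proof.
move=> p0 q0.
have -> : N%:R * ((2 * T)%:R * p + N%:R * q) =
    \sum_(i <- index_iota 1 N.+1) ((2 * T)%:R * p + N%:R * q).
  by rewrite big_const_seq count_predT size_iota subn1 /= iter_addr_0 mulr_natl.
apply: ler_sum => i _; apply: (le_trans (sum_if_le _ _ p0 q0)).
rewrite size_iota subn1 lerD2r ler_wpM2r// ler_nat; exact: count_close.
Qed.

(** Strictly increasing integers grow by at least one per step; this turns separation of indices
    into separation of times. *)
Lemma strict_incr_gap (a : nat -> nat) :
  (forall n m : nat, (1 <= n)%N -> (n < m)%N -> (a n < a m)%N) ->
  forall i j : nat, (1 <= i)%N -> (i <= j)%N -> (a i + (j - i) <= a j)%N.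
Proof.
move=> Ha i j i1 ij; rewrite -{2}(subnKC ij); elim: (j - i)%N => [|n IH]; first by rewrite !addn0.
rewrite !addnS; apply: leq_ltn_trans IH _; apply: Ha => //; lia.
Qed.

End Counting.

(** * Decay of correlations along the sequence *)

Section Correlations.
Variables (R : realType) (B : 'M[R]_(2 * 2)) (Gam : set 'M[R]_2).
Hypotheses (HB : posdef B) (HGsub : is_subgroup Gam).
Variable mu : probability (XM B Gam) R.
Hypothesis Hinv : forall g, SL2 g -> forall A : set (XM B Gam), measurable A ->
  mu (act g @^-1` A) = mu A.
Local Notation X := (XM B Gam).

Lemma integral_act (h : X -> R) (M : R) g : SL2 g -> measurable_fun setT h ->
  (forall x, `|h x| <= M) ->
  (\int[mu]_x (h (act g x))%:E = \int[mu]_x (h x)%:E)%E.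
Proof.
move=> Hg mh hM; have ma : measurable_fun setT (act g : X -> X) by exact: measurable_act.
have e : (\int[mu]_x (h x)%:E = \int[pushforward mu (act g : X -> X)]_x (h x)%:E)%E.
  by apply: eq_measure_integral => A mA _; rewrite /pushforward; apply/esym; exact: Hinv.
rewrite e integral_pushforward//; first exact/measurable_EFinP.
rewrite preimage_setT.
have mc : measurable_fun setT (fun x : X => h (act g x)) by exact: (measurableT_comp mh ma).
exact: (@integrable_bounded _ X R mu (fun x : X => h (act g x)) M mc (fun x => hM _)).
Qed.

Variables (f : X -> R) (M C alpha : R) (a : nat -> nat).
Hypotheses (mf : measurable_fun setT f) (fM : forall x, `|f x| <= M).
Hypotheses (C0 : 0 < C) (Halpha : 0 < alpha).
Hypothesis Hmix : forall n : nat, (1 <= n)%N ->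
  (`| \int[mu]_x ((f (act (u n%:R) x) * f x)%:E) | <= (C * n%:R `^ (- alpha))%:E)%E.
Hypothesis Ha : forall n m : nat, (1 <= n)%N -> (n < m)%N -> (a n < a m)%N.

Let F (i : nat) (x : X) := f (act (u (a i)%:R) x).

Let mF i : measurable_fun setT (F i).
Proof. exact: (measurableT_comp mf (measurable_act HB HGsub (SL2_u _))). Qed.

(** By invariance under [u_(a_i)] the correlation equals the one at time [a_j - a_i], which is at
    least [T], and the mixing rate is decreasing. *)
Lemma correlation_far (T i j : nat) : (1 <= T)%N -> (1 <= i)%N -> (i + T <= j)%N ->
  (`| \int[mu]_x (F i x * F j x)%:E | <= (C * T%:R `^ (- alpha))%:E)%E.
Proof.
move=> T1 i1 ij; have gap := strict_incr_gap Ha i1 (leq_trans (leq_addr T i) ij).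
pose n := (a j - a i)%N; have Tn : (T <= n)%N by rewrite /n; lia.
pose h (x : X) := f (act (u n%:R) x) * f x.
have -> : (\int[mu]_x (F i x * F j x)%:E = \int[mu]_x (h x)%:E)%E.
  rewrite -(@integral_act h (M * M) (u (a i)%:R)).
  - apply: eq_integral => x _; congr (_%:E); rewrite /F /h mulrC actM ?u_add -?natrD ?subnK//.
    + by rewrite /n; lia.
    + exact: SL2_u.
    + exact: SL2_u.
  - exact: SL2_u.
  - apply: measurable_funM => //.
    exact: (measurableT_comp mf (measurable_act HB HGsub (SL2_u _))).
  - by move=> x; rewrite /h normrM ler_pM.
apply: (le_trans (Hmix (leq_trans T1 Tn))).
rewrite lee_fin ler_pM2l// !powRN lef_pV2 ?posrE ?powR_gt0 ?ltr0n ?(leq_trans T1)//.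
by apply: ge0_ler_powR; rewrite ?nnegrE ?ler0n ?ler_nat// ltW.
Qed.

(** With [N = T^2], the at most [2 T N] pairs of indices closer than [T] are bounded trivially by
    [M^2], the others by mixing. Division by [N^2] and the Chebyshev inequality give the two
    terms. *)
Lemma avg_tail_sqr (T : nat) (e : R) : (1 <= T)%N -> 0 < e ->
  (mu [set x : X | (e < `|avg f a x (T * T)|)%R] <=
   (e ^- 2 * (2 * M ^+ 2 / T%:R + C * T%:R `^ (- alpha)))%:E)%E.
Proof.
move=> T1 e0; pose N := (T * T)%N; pose q := C * T%:R `^ (- alpha).
have q0 : 0 <= q by rewrite mulr_ge0 ?powR_ge0// ltW.
have T0 : 0 < (T%:R : R) by rewrite ltr0n.
have S2 : (\int[mu]_x ((\sum_(i <- index_iota 1 N.+1) F i x) ^+ 2)%:E <=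
    (N%:R * ((2 * T)%:R * (M * M) + N%:R * q))%:E)%E.
  apply: le_trans (second_moment_le mF (fun i x => fM _)
    (c := fun i j => if (i < j + T)%N && (j < i + T)%N then M * M else q) _) _.
    move=> i j; rewrite !mem_index_iota => /andP[i1 iN] /andP[j1 jN].
    case: ifPn => [_|].
      apply: (@integral_bounded_le _ _ _ _ (fun x => F i x * F j x)).
        exact: measurable_funM.
      by move=> x; rewrite normrM ler_pM//; exact: fM.
    rewrite negb_and -!leqNgt => /orP[ji|ij]; last exact: correlation_far.
    have -> : (\int[mu]_x (F i x * F j x)%:E = \int[mu]_x (F j x * F i x)%:E)%E.
      by apply: eq_integral => x _; rewrite mulrC.
    exact: correlation_far.
  by rewrite lee_fin; apply: sum_close_far => //; rewrite -expr2 sqr_ge0.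
have mS : measurable_fun setT (fun x : X => avg f a x N).
  by apply: measurable_funM => //; apply: measurable_sum => i; exact: mF.
apply: le_trans (@Markov_sqr _ _ _ mu (fun x : X => avg f a x N) e
  (N%:R^-1 ^+ 2 * (N%:R * ((2 * T)%:R * (M * M) + N%:R * q))) mS e0 _) _; last first.
  rewrite lee_fin ler_pM2l ?invr_gt0 ?exprn_gt0// le_eqVlt; apply/orP; left; apply/eqP.
  by rewrite -/q /N !natrM; field; rewrite gt_eqF.
have -> : (\int[mu]_x (avg f a x N ^+ 2)%:E =
    \int[mu]_x ((N%:R^-1 ^+ 2)%:E * ((\sum_(i <- index_iota 1 N.+1) F i x) ^+ 2)%:E))%E.
  by apply: eq_integral => x _; rewrite /avg exprMn.
rewrite ge0_integralZl//.
- by rewrite [leRHS]EFinM; apply: lee_wpmul2l => //; rewrite lee_fin sqr_ge0.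
- apply/measurable_EFinP; apply: measurable_funX.
  by apply: measurable_sum => i; exact: mF.
- by move=> x _; rewrite lee_fin sqr_ge0.
Qed.

(** The case [T = k^m]: [p <= m] and [p <= alpha m] bring both terms below a constant times
    [k^-p]. *)
Lemma avg_tail (m k p : nat) (e : R) : (p <= m)%N -> p%:R <= alpha * m%:R ->
  (1 <= k)%N -> 0 < e ->
  (mu [set x : X | (e < `|avg f a x (k ^ (2 * m))|)%R] <=
   (e ^- 2 * ((2 * M ^+ 2 + C) / k%:R ^+ p))%:E)%E.
Proof.
move=> pm pam k1 e0.
have k0 : 0 < (k%:R : R) by rewrite ltr0n.
have k1R : 1 <= (k%:R : R) by rewrite ler1n.
have kpm : (k%:R : R) ^+ p <= k%:R ^+ m by exact: ler_weXn2l.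
rewrite mulnC expnM -mulnn.
apply: le_trans (avg_tail_sqr _ e0) _; first by rewrite expn_gt0 k1.
rewrite lee_fin ler_pM2l ?invr_gt0 ?exprn_gt0// [leRHS]mulrDl lerD//.
  apply: ler_wpM2l; first by rewrite mulr_ge0// sqr_ge0.
  by rewrite natrX lef_pV2 ?posrE ?exprn_gt0.
rewrite ler_pM2l// powRN lef_pV2 ?posrE ?exprn_gt0 ?powR_gt0 ?ltr0n ?expn_gt0 ?k1//.
rewrite natrX -!powR_mulrn ?ler0n// -powRrM; apply: ler_powR => //.
by rewrite mulrC.
Qed.

End Correlations.

(** * Packing and Hausdorff content *)

Section Packing.
Variables (R : realType) (B : 'M[R]_(2 * 2)) (Gam : set 'M[R]_2).
Hypotheses (HB : posdef B) (HGsub : is_subgroup Gam).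
Variable mu : probability (XM B Gam) R.
Local Notation X := (XM B Gam).

Lemma ball_act_meet r (x y z : Xq Gam) : r <= 1 ->
  ball_act r x z -> ball_act r y z -> ball_act (9 * r) x y.
Proof.
move=> r1 [k kr <-] [h hr e].
have Hk := near1_SL2 kr; have Hh := near1_SL2 hr.
exists (invmx h *m k); last by rewrite -(actM _ (SL2_inv Hh) Hk) -e actK.
have -> : invmx h *m k = invmx h *m invmx (invmx k) by rewrite invmxK.
by apply: near1_div => //; exact: near1_inv.
Qed.

(* A family of disjoint balls that cannot be enlarged yields a cover by balls nine
   times as large; the lower bound [v] on the measures limits its size. *)
Lemma packing_cover (E E' : set X) (r v : R) : 0 < v -> r <= 1 -> measurable E' ->
  (forall y, E y -> (v%:E <= mu (ball_act r y : set X))%E) ->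
  (forall y, E y -> ball_act r y `<=` E') ->
  exists s : seq X, [/\ (((size s)%:R * v)%:E <= mu E')%E,
    (forall y, y \in s -> E y) &
    forall x, E x -> exists2 y, y \in s & ball_act (9 * r) y x].
Proof.
move=> v0 r1 mE' Ev EE'.
pose fix packed (s : seq X) : Prop := if s is z :: s' then
  [/\ E z, packed s' & forall y, y \in s' -> ball_act r z `&` ball_act r y = set0]
  else True.
have packed_in s : packed s -> forall y, y \in s -> E y.
  elim: s => //= z s IH [Ez /IH Hs _] y; rewrite in_cons => /orP[/eqP->//|]; exact: Hs.
pose U (s : seq X) : set X := foldr (fun y V => ball_act r y `|` V) set0 s.
have mb y : measurable (ball_act r y : set X) by exact: measurable_ball_act.
have mU s : measurable (U s) by elim: s => [|y s IH] /=; [exact: measurable0|exact: measurableU].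
have UE s x : U s x -> exists2 y, y \in s & ball_act r y x.
  elim: s => //= y s IH [|/IH[z zs]]; first by exists y; rewrite ?mem_head.
  by exists z; rewrite ?in_cons ?zs ?orbT.
have vU s : packed s -> (((size s)%:R * v)%:E <= mu (U s))%E.
  elim: s => [|z s IH] /=; first by rewrite mul0r.
  move=> [Ez /IH Hs disj]; rewrite measureU//; last first.
    rewrite -subset0 => x [zx /UE[y ys yx]].
    by rewrite -(disj y ys); split.
  rewrite -natr1 mulrDl mul1r addrC EFinD; apply: leeD => //; exact: Ev.
have UE' s : packed s -> U s `<=` E'.
  by move=> /packed_in Hs x /UE[y /Hs Ey]; exact: EE'.
apply: contrapT => H.
(* If no packed list satisfied the conclusion, each could be extended by an uncovered point, since
   [ball_act_meet] makes its ball disjoint from the others. Lists longer than [1 / v] would then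
   have total measure above 1. *)
have grow n : exists2 s, packed s & size s = n.
  elim: n => [|n [s Ps <-]]; first by exists [::].
  apply: contrapT => H'; apply: H; exists s; split.
  - apply: le_trans (vU _ Ps) _; apply: le_measure; rewrite ?inE//; exact: UE'.
  - exact: packed_in.
  - move=> x Ex; apply: contrapT => nx; apply: H'; exists (x :: s) => //=; split => // y ys.
    rewrite -subset0 => z [xz yz]; apply: nx; exists y => //.
    exact: ball_act_meet yz xz.
have [s Ps sn] := grow (Num.bound v^-1).
have := le_trans (vU _ Ps) (probability_le1 mu (mU s)).
rewrite lee_fin sn -ler_pdivlMr// div1r leNgt archi_boundP// invr_ge0; exact: ltW.
Qed.

End Packing.

(** * From countable covers to Hausdorff dimension *)

Section HausdorffCovers.
Variables (R : realType) (T : Type) (D : T -> T -> \bar R).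
Implicit Types (A V : set T).

Lemma cover_term_ge0 s V : (0 <= cover_term D s V)%E.
Proof. by rewrite /cover_term; case: asboolP => // _; rewrite lee_fin powR_ge0. Qed.

Lemma cover_term0 s : cover_term D s set0 = 0%E.
Proof. by rewrite /cover_term; case: asboolP. Qed.

Lemma cover_term_le s V (r : R) : (forall x y, (0 <= D x y)%E) -> 0 <= s -> 0 <= r ->
  (ediam D V <= r%:E)%E -> (cover_term D s V <= (r `^ s)%:E)%E.
Proof.
move=> D0 s0 r0 Vr; rewrite /cover_term; case: asboolP => [_|V0].
  by rewrite lee_fin powR_ge0.
have [x Vx] : V !=set0 by apply/set0P/eqP.
have d0 : (0 <= ediam D V)%E.
  by apply: (le_trans (D0 x x)); apply: ereal_sup_ubound; exists x, x.
rewrite lee_fin; apply: ge0_ler_powR => //; rewrite ?nnegrE ?fine_ge0//.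
by rewrite -lee_fin fineK// ge0_fin_numE// (le_lt_trans Vr)// ltry.
Qed.

(** Covers arise as one finite family for each [k], whereas the content is defined by a single
    sequence of sets; this lemma bridges the two. *)
Lemma hcontent_le_seq s delta (eta : R) A (W : nat -> seq (set T)) :
  (forall k V, V \in W k -> (ediam D V <= delta%:E)%E) ->
  (forall x, A x -> exists k, exists2 V, V \in W k & V x) ->
  (forall n, (\sum_(k <- iota 0 n) \sum_(V <- W k) cover_term D s V <= eta%:E)%E) ->
  (hcontent D s delta A <= eta%:E)%E.
Proof.
move=> Wd AW Weta.
(* Padding each block with [set0] makes the first [n] blocks contain at least [n]
   sets, so that the concatenation can be enumerated by its finite prefixes. *)
pose L n := flatten [seq set0 :: W k | k <- iota 0 n].
have LS n : L n.+1 = L n ++ (set0 :: W n).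
  by rewrite /L -addn1 iotaD map_cat flatten_cat /= cats0.
have sL n : (n <= size (L n))%N.
  by elim: n => // n IH; rewrite LS size_cat /=; lia.
have Lmono i n k : (i < size (L n))%N -> nth set0 (L (n + k)%N) i = nth set0 (L n) i.
  move=> si; have : (i < size (L (n + k)%N))%N.
    by elim: k => [|k IH]; rewrite ?addn0// addnS LS size_cat; lia.
  elim: k => [|k IH]; rewrite ?addn0// addnS => _.
  have sk : (i < size (L (n + k)%N))%N.
    clear IH; elim: k => [|k IH]; rewrite ?addn0// addnS LS size_cat; lia.
  by rewrite LS nth_cat sk IH.
pose U i := nth set0 (L i.+1) i.
have UL n i : (i < size (L n))%N -> U i = nth set0 (L n) i.
  move=> si; have [ni|ni] := leqP n i.+1.
    by rewrite /U -(subnKC ni) Lmono.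
  by rewrite /U -(Lmono i i.+1 (n - i.+1)%N (sL _)) subnKC// ltnW.
have LW n V : V \in L n -> V = set0 \/ exists k, V \in W k.
  move=> /flattenP[l /mapP[k _ ->]]; rewrite in_cons => /orP[/eqP->|Vk]; first by left.
  by right; exists k.
apply: (@le_trans _ _ (\sum_(0 <= i <oo) cover_term D s (U i))%E).
  apply: ereal_inf_lbound; exists U => //; split.
    move=> x /AW[k [V Vk Vx]].
    have VL : V \in L k.+1 by rewrite LS mem_cat in_cons Vk !orbT.
    exists (index V (L k.+1)) => //.
    by rewrite (UL k.+1) ?index_mem// nth_index.
  move=> i; have /LW[->|[k Uk]] : U i \in L i.+1 by rewrite /U mem_nth.
    by rewrite /ediam; apply: ge_ereal_sup => _ [x [y [[]]]].
  exact: Wd Uk.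
apply: lime_le; first by apply: is_cvg_nneseries => i _ _; exact: cover_term_ge0.
apply: nearW => n; apply: le_trans (Weta n).
have -> : (\sum_(k <- iota 0 n) \sum_(V <- W k) cover_term D s V =
    \sum_(V <- L n) cover_term D s V)%E.
  rewrite /L big_flatten big_map; apply: eq_bigr => k _.
  by rewrite big_cons cover_term0 /= add0e.
rewrite [leRHS](big_nth set0) (big_cat_nat (leq0n n) (sL n)) /=.
rewrite (eq_big_nat _ _ (F2 := fun i => cover_term D s (nth set0 (L n) i))); last first.
  by move=> i /andP[_ ni]; rewrite (UL n)// (leq_trans ni).
by rewrite leeDl// sume_ge0// => i _; exact: cover_term_ge0.
Qed.

Lemma hdim_le s A : 0 <= s ->
  (forall delta eta, 0 < delta -> 0 < eta -> (hcontent D s delta A <= eta%:E)%E) ->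
  (hdim D A <= s%:E)%E.
Proof.
move=> s0 H; apply: ereal_inf_lbound; exists s => //; split => //.
have hc0 delta : 0 < delta -> hcontent D s delta A = 0%E.
  move=> d0; apply/eqP; rewrite eq_le; apply/andP; split.
    by apply/lee_addgt0Pr => e e0; rewrite add0e; exact: H.
  apply: le_ereal_inf_tmp => _ [U _ <-].
  by apply: nneseries_ge0 => i _ _; exact: cover_term_ge0.
rewrite /hmeasure; apply/eqP; rewrite eq_le; apply/andP; split.
  by apply: ge_ereal_sup => _ [delta /= d0 <-]; rewrite hc0.
by apply: ereal_sup_ubound; exists 1 => //=; exact: hc0.
Qed.

End HausdorffCovers.

(** * Reduction to a polynomial subsequence *)

Section Subsequence.
Variable R : realType.

Lemma limn_esup_gt0 (v : nat -> R) : (0 < limn_esup (fun N => (v N)%:E))%E ->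
  exists2 e : R, 0 < e & forall n0, exists2 N, (n0 <= N)%N & e < v N.
Proof.
move=> H; apply: contrapT => nH.
have lime e : 0 < e -> (limn_esup (fun N => (v N)%:E) <= e%:E)%E.
  move=> e0; have [n0 Hn0] : exists n0, forall N, (n0 <= N)%N -> v N <= e.
    apply: contrapT => nn; apply: nH; exists e => // n0.
    apply: contrapT => nN; apply: nn; exists n0 => N n0N.
    by rewrite leNgt; apply/negP => eN; apply: nN; exists N.
  apply: (@le_trans _ _ (ereal_sup [set (v N)%:E | N in [set N | (n0 <= N)%N]])).
    by apply: ereal_inf_lbound; exists [set N | (n0 <= N)%N] => //; exists n0.
  by apply: ge_ereal_sup => _ [N /= n0N <-]; rewrite lee_fin Hn0.
suff : (limn_esup (fun N => (v N)%:E) <= 0)%E by rewrite leNgt H.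
by apply/lee_addgt0Pr => e e0; rewrite add0e; exact: lime.
Qed.

(** The chord of a convex function over [[0, 1]]. In the induction the defect is
    [(2^q - 1) x (1 - x)]. *)
Lemma expr1D_le (x : R) q : 0 <= x <= 1 -> (1 + x) ^+ q <= 1 + (2 ^+ q - 1) * x.
Proof.
move=> /andP[x0 x1]; elim: q => [|q IH]; first by rewrite !expr0 subrr mul0r addr0.
have q1 : 1 <= 2 ^+ q :> R by rewrite exprn_ege1//; lra.
rewrite exprSr; apply: (@le_trans _ _ ((1 + (2 ^+ q - 1) * x) * (1 + x))).
  by rewrite ler_wpM2r//; lra.
rewrite [in leRHS]exprS; have : 0 <= (2 ^+ q - 1) * (x * (1 - x)).
  by rewrite mulr_ge0 ?subr_ge0// mulr_ge0// subr_ge0.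
lra.
Qed.

(* Consecutive terms of [k ^ q] have ratio tending to 1, so averages of a bounded
   sequence are controlled by the averages along [k ^ q]. *)
Lemma averages_subsequence (g : nat -> R) (M : R) (q : nat) (e : R) :
  (0 < q)%N -> (forall i, `|g i| <= M) -> 0 < e ->
  (forall n0, exists2 N, (n0 <= N)%N & e < `|N%:R^-1 * \sum_(1 <= i < N.+1) g i|) ->
  forall k0, exists2 k, (k0 <= k)%N &
    e / 2 < `|((k ^ q)%N)%:R^-1 * \sum_(1 <= i < (k ^ q).+1) g i|.
Proof.
move=> q0 gM e0 H k0.
have M0 : 0 <= M by apply: le_trans (gM 0%N).
(* Large enough that [M 2^q / k <= e / 2] for [k >= k1], which makes the terms beyond [k^q]
   harmless. *)
pose k1 := maxn (maxn k0 1) (Num.bound (2 * (M * 2 ^+ q) / e)).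
have [N Nk NE] := H (k1 ^ q)%N.
have exk : exists k, (k ^ q <= N)%N by exists k1.
have ubk k : (k ^ q <= N)%N -> (k <= N)%N.
  by apply: leq_trans; case: k => // k; rewrite -{1}(expn1 k.+1) leq_pexp2l.
have [k kN kmax] := ex_maxnP exk ubk.
have k1k : (k1 <= k)%N by exact: kmax.
exists k; first by apply: leq_trans k1k; rewrite !leq_max leqnn.
have kpos : (0 < k)%N by apply: leq_trans k1k; rewrite !leq_max orbT.
have Nk1 : (N < k.+1 ^ q)%N by rewrite ltnNge; apply/negP => /kmax; rewrite ltnn.
set n := (k ^ q)%N in kN *; have n0 : (0 < n)%N by rewrite expn_gt0 kpos.
have nR : 0 < (n%:R : R) by rewrite ltr0n.
have NR : 0 < (N%:R : R) by rewrite ltr0n (leq_trans n0).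
have split_sum : \sum_(1 <= i < N.+1) g i =
    \sum_(1 <= i < n.+1) g i + \sum_(n.+1 <= i < N.+1) g i by rewrite (@big_cat_nat _ _ _ n.+1).
have tail : `|\sum_(n.+1 <= i < N.+1) g i| <= (N%:R - n%:R) * M.
  apply: (le_trans (ler_norm_sum _ _ _)).
  apply: (@le_trans _ _ (\sum_(n.+1 <= i < N.+1) M)); first by apply: ler_sum.
  by rewrite sumr_const_nat subSS -natrB// mulr_natl.
have kR : 0 < (k%:R : R) by rewrite ltr0n.
(* Maximality of [k] gives [N < (k + 1)^q], so [N / n] is at most [(1 + 1/k)^q]. *)
have Nn : N%:R - n%:R <= 2 ^+ q * k%:R^-1 * n%:R :> R.
  have : N%:R <= (1 + k%:R^-1) ^+ q * n%:R :> R.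
    rewrite /n natrX -exprMn mulrDl mul1r mulVf ?gt_eqF// natr1 -natrX ler_nat ltnW//.
  have /(expr1D_le q) : 0 <= (k%:R : R)^-1 <= 1.
    by rewrite invr_ge0 (ltW kR) invf_le1// ler1n.
  set z := _ ^+ q; set y := 2 ^+ q => h1 h2.
  have : z * n%:R <= (1 + (y - 1) * k%:R^-1) * n%:R by rewrite ler_pM2r.
  have : 0 <= k%:R^-1 * n%:R :> R by rewrite mulr_ge0 ?invr_ge0 ?ltW.
  lra.
have kb : 2 * (M * 2 ^+ q) / e <= k%:R.
  apply: (@le_trans _ _ k1%:R); last by rewrite ler_nat.
  apply: le_trans (ltW (archi_boundP _)) _; last by rewrite ler_nat leq_max leqnn orbT.
  by rewrite divr_ge0 ?(ltW e0)// !mulr_ge0// exprn_ge0.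
have kb' : M * (2 ^+ q * k%:R^-1) <= e / 2.
  by rewrite mulrA ler_pdivrMr//; rewrite ler_pdivrMr// in kb; lra.
move: NE; rewrite !normrM !normfV !(ger0_norm (ltW nR)) !(ger0_norm (ltW NR)).
rewrite ltr_pdivlMl// ltr_pdivlMl// => NE.
have eN : n%:R * e <= N%:R * e by rewrite ler_pM2r// ler_nat.
have tl : (N%:R - n%:R) * M <= e / 2 * n%:R.
  apply: (@le_trans _ _ (2 ^+ q * k%:R^-1 * n%:R * M)); first by rewrite ler_wpM2r.
  by rewrite mulrAC ler_pM2r// mulrC.
move: NE; rewrite split_sum; have := ler_normD (\sum_(1 <= i < n.+1) g i) (\sum_(n.+1 <= i < N.+1) g i).
lra.
Qed.

End Subsequence.

(** The count of powers of [k] that dictates the exponent 11: the Chebyshev threshold costs [k^2],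
    the ball measure at height [k] costs [k^6], the bound on [t] costs [k], and
    [2 + 6 + 1 - 11 = -2] is summable. The powers of [r] cancel. *)
Lemma block_sum_bound (R : realType) (n m0 r k D Lam S t : R) :
  0 <= n -> 0 < m0 -> 0 < r -> 0 < k -> 0 <= Lam -> 0 <= S ->
  n * (m0 * (r / (8 * k ^+ 2)) ^+ 3) <= 4 * k ^+ 2 * (D / k ^+ 11) ->
  t <= r ^+ 3 * (Lam * k) ->
  n * (S * t) <= 2048 * D / m0 * Lam * S / k ^+ 2.
Proof.
move=> n0 m00 r0 k0 Lam0 S0 nv tr.
have kn := lt0r_neq0 k0; have mn := lt0r_neq0 m00.
have nr3 : n * r ^+ 3 <= 2048 * D / m0 / k ^+ 3.
  have -> : n * r ^+ 3 = n * (m0 * (r / (8 * k ^+ 2)) ^+ 3) * (512 * k ^+ 6 / m0).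
    by field; rewrite kn mn.
  have -> : 2048 * D / m0 / k ^+ 3 = 4 * k ^+ 2 * (D / k ^+ 11) * (512 * k ^+ 6 / m0).
    by field; rewrite kn mn.
  apply: ler_wpM2r nv; apply: divr_ge0 (ltW m00).
  by apply: mulr_ge0; [exact: ler0n|exact: exprn_ge0 (ltW k0)].
apply: (@le_trans _ _ (n * (S * (r ^+ 3 * (Lam * k))))).
  by apply: ler_wpM2l n0 _ _ _; apply: ler_wpM2l S0 _ _ tr.
have -> : n * (S * (r ^+ 3 * (Lam * k))) = n * r ^+ 3 * (S * (Lam * k)) by ring.
have -> : 2048 * D / m0 * Lam * S / k ^+ 2 = 2048 * D / m0 / k ^+ 3 * (S * (Lam * k)).
  by field; rewrite kn mn.
by apply: ler_wpM2r nr3; rewrite mulr_ge0// mulr_ge0// ltW.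
Qed.

(** * The exceptional sets *)

Section ExceptionalSet.
Variables (R : realType) (B : 'M[R]_(2 * 2)) (Gam : set 'M[R]_2).
Hypotheses (HB : posdef B) (HGsub : is_subgroup Gam).
Variable mu : probability (XM B Gam) R.
Hypothesis Hinv : forall g, SL2 g -> forall A : set (XM B Gam), measurable A ->
  mu (act g @^-1` A) = mu A.
Local Notation X := (XM B Gam).
Local Notation x0 := (Xq_pt Gam).
Local Notation dX := (@distX R B Gam).

Lemma ediam_ball_act : exists2 L : R, 0 < L & forall (r : R) (y : Xq Gam), 36 * r <= 1 ->
  (ediam dX (ball_act r y) <= (L * r)%:E)%E.
Proof.
have [L L0 HL] := distX_near1_le B HGsub.
exists (9 * L); first by rewrite mulr_gt0.
move=> r y r36; apply: ge_ereal_sup => _ [_ [_ [[k kr <-] [[h hr <-] ->]]]].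
have Hk := near1_SL2 kr; have Hh := near1_SL2 hr; have r0 := near1_gt0 kr.
have hk : near1 (9 * r) (h *m invmx k) by apply: near1_div => //; lra.
have -> : act h y = act (h *m invmx k) (act k y).
  rewrite actM//; last by apply: near1_SL2 hk.
  by rewrite SL2_mulmxKV.
have -> : 9 * L * r = L * (9 * r) by ring.
by apply: HL => //; lra.
Qed.

(** For [y = k x] the points [u_a x] and [u_a y] differ by [u_a k u_a^-1], which is within [8 H^2 r]
    of 1. The condition on [H] and [r] keeps this below the [1/4] required by [distX_near1_le]. *)
Lemma avg_Lipschitz (f : X -> R) (K : R) (a : nat -> nat) :
  (forall x y, (`|f x - f y|%:E <= K%:E * distX B x y)%E) ->
  exists2 L : R, 0 < L & forall (N : nat) (H r : R) (x y : X),
    (forall i, (1 <= i <= N)%N -> 1 + (a i)%:R <= H) ->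
    32 * H ^+ 2 * r <= 1 -> ball_act r x y -> (0 < N)%N -> 1 <= H ->
    `|avg f a x N - avg f a y N| <= L * H ^+ 2 * r.
Proof.
move=> fK; have [L L0 HL] := distX_near1_le B HGsub.
exists (8 * ((`|K| + 1) * L)); first by rewrite !mulr_gt0// ltr_wpDl.
move=> N H r x y aH Hr [k kr <-] N0 H1.
have NR : 0 < (N%:R : R) by rewrite ltr0n.
have Hk := near1_SL2 kr; have r_gt0 := near1_gt0 kr.
have H0 : 0 < H by lra.
rewrite /avg -mulrBr -sumrB normrM normfV (ger0_norm (ltW NR)) ler_pdivrMl//.
apply: (le_trans (ler_norm_sum _ _ _)).
apply: (@le_trans _ _ (\sum_(1 <= i < N.+1) 8 * ((`|K| + 1) * L) * H ^+ 2 * r)); last first.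
  by rewrite sumr_const_nat subSS subn0 [leRHS]mulr_natl.
rewrite big_nat [leRHS]big_nat; apply: ler_sum => i iN.
set g := u (a i)%:R; have Hg : SL2 g := SL2_u _.
have gH : mxle g H by apply: mxleW (aH i iN) (mxle_u _); rewrite ler0n.
have kc := near1_conj Hg H0 gH kr.
have -> : act g (act k x) = act (g *m k *m invmx g) (act g x).
  by rewrite (actM _ Hg Hk) (actM _ (near1_SL2 kc) Hg) SL2_mulmxKV.
have dle := HL _ _ (act g x) (_ : 8 * H ^+ 2 * r <= 1 / 4) kc.
have {}dle := dle ltac:(lra).
rewrite -lee_fin; apply: (le_trans (fK _ _)).
apply: (@le_trans _ _ ((`|K| + 1)%:E * distX B (act g x) (act (g *m k *m invmx g) (act g x)))%E).
  by apply: lee_wpmul2r; [exact: distX_ge0|rewrite lee_fin (le_trans (ler_norm _))// lerDl].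
apply: (@le_trans _ _ ((`|K| + 1)%:E * (L * (8 * H ^+ 2 * r))%:E)%E).
  by apply: lee_wpmul2l => //; rewrite lee_fin addr_ge0.
by rewrite -EFinM lee_fin le_eqVlt; apply/orP; left; apply/eqP; ring.
Qed.

Variables (d m : nat) (f : X -> R) (M K C C' alpha : R) (a : nat -> nat).
Hypotheses (d0 : (0 < d)%N) (m11 : (11 <= m)%N) (am11 : 11 <= alpha * m%:R).
Hypothesis Halpha : 0 < alpha.
Hypothesis fM : forall x, `|f x| <= M.
Hypothesis fK : forall x y, (`|f x - f y|%:E <= K%:E * distX B x y)%E.
Hypothesis C0 : 0 < C.
Hypothesis Hmix : forall n : nat, (1 <= n)%N ->
  (`| \int[mu]_x ((f (act (u n%:R) x) * f x)%:E) | <= (C * n%:R `^ (- alpha))%:E)%E.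
Hypothesis Ha : forall n p : nat, (1 <= n)%N -> (n < p)%N -> (a n < a p)%N.
Hypothesis C'0 : 0 < C'.
Hypothesis Hgrowth : forall n : nat, (1 <= n)%N -> (a n)%:R <= C' * n%:R ^+ d.

Let s : R := 3 - (8 * m%:R)^-1 / d%:R.

(** The second clause restricts to points with a representative of size [k], where balls have a
    uniform lower bound on their measure; every point meets it for all large [k]. *)
Definition exceptional (k : nat) : set X := [set x | k%:R^-1 < `|avg f a x (k ^ (2 * m))| /\
  exists g, [/\ SL2 g, mxle g k%:R & x = act g x0]].

Let m0R : 0 < (m%:R : R). Proof. by rewrite ltr0n (leq_trans _ m11). Qed.
Let d0R : 0 < (d%:R : R). Proof. by rewrite ltr0n. Qed.
Let d1R : 1 <= (d%:R : R). Proof. by rewrite ler1n. Qed.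
Let m1R : 1 <= (m%:R : R). Proof. by rewrite ler1n (leq_trans _ m11). Qed.

Lemma dimension_ge0 : 0 <= s.
Proof.
have h1 : (8 * m%:R)^-1 <= 1 :> R by rewrite invf_le1 ?mulr_gt0//; have := m1R; lra.
have h2 : (8 * m%:R)^-1 / d%:R <= (8 * m%:R)^-1 :> R.
  by rewrite ler_pdivrMr// ler_peMr// invr_ge0 mulr_ge0// ltW.
by rewrite /s; lra.
Qed.

(** With [e = 4md + 1] and [th = 1 / (8md)], the left side is [rho^-3 rho^th]. Here
    [rho <= (Lam k)^e] and [e th <= 1], because [4md + 1 <= 8md]. *)
Lemma radius_power (Lam : R) (k : nat) : 1 <= Lam -> (1 <= k)%N ->
  (Lam * k%:R ^+ (4 * m * d + 1))^-1 `^ s <=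
  (Lam * k%:R ^+ (4 * m * d + 1))^-1 ^+ 3 * (Lam * k%:R).
Proof.
move=> Lam1 k1; have k1R : 1 <= (k%:R : R) by rewrite ler1n.
set e := (4 * m * d + 1)%N; set rho := Lam * _.
have k0R : 0 < (k%:R : R) by rewrite ltr0n.
have Lam0 : 0 < Lam by lra.
have rho0 : 0 < rho by rewrite mulr_gt0// exprn_gt0.
rewrite /s powRD; last by rewrite invr_eq0 (gt_eqF rho0) implybT.
rewrite -[X in _ `^ X * _]/(3%:R) powR_mulrn ?invr_ge0 ?(ltW rho0)//.
apply: ler_wpM2l; first by rewrite exprn_ge0// invr_ge0 ltW.
set th := _ / _.
have th0 : 0 <= th by rewrite divr_ge0 ?invr_ge0 ?mulr_ge0 ?(ltW m0R) ?(ltW d0R).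
rewrite -(powR_inv1 (ltW rho0)) -powRrM mulN1r opprK.
have Lk1 : 1 <= Lam * k%:R by rewrite mulr_ege1.
have Lk0 : 0 <= Lam * k%:R by exact: le_trans ler01 Lk1.
apply: (@le_trans _ _ (((Lam * k%:R) ^+ e) `^ th)).
  apply: ge0_ler_powR; rewrite ?nnegrE ?exprn_ge0 ?(ltW rho0)//.
  rewrite /rho exprMn ler_pM2r ?exprn_gt0//.
  by rewrite /e addn1 exprS ler_peMr ?(ltW Lam0)// exprn_ege1.
rewrite -powR_mulrn//.
rewrite -powRrM -[leRHS]powRr1//.
apply: ler_powR => //.
rewrite /th /e natrD !natrM mulrA ler_pdivrMr// mul1r ler_pdivrMr ?mulr_gt0//.
have : 1 <= m%:R * d%:R :> R by rewrite mulr_ege1.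
lra.
Qed.

Let mf : measurable_fun setT f.
Proof. exact: measurable_Lipschitz fK. Qed.

(** The radius is [1 / (Lam k^(4md + 1))]: the power [4md] offsets the expansion [N^(2d)] at
    [N = k^(2m)], the extra [k] makes the oscillation small against the threshold [1/k], and [Lam]
    absorbs constants. *)
Lemma radius_exists (Lam : R) (k : nat) : 1 <= Lam -> (1 <= k)%N ->
  exists r : R, [/\ 0 < r, r <= Lam^-1, r <= k%:R^-1,
    k%:R ^+ (4 * m * d) * r = Lam^-1 / k%:R & r `^ s <= r ^+ 3 * (Lam * k%:R)].
Proof.
move=> Lam1 k1; exists (Lam * k%:R ^+ (4 * m * d + 1))^-1.
have k1R : 1 <= (k%:R : R) by rewrite ler1n.
have k0R : 0 < (k%:R : R) by rewrite ltr0n.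
have Lam0 : 0 < Lam by exact: lt_le_trans ltr01 Lam1.
have rs := radius_power Lam1 k1; split=> //.
- by rewrite invr_gt0 mulr_gt0// exprn_gt0.
- by rewrite lef_pV2 ?posrE ?mulr_gt0 ?exprn_gt0// ler_peMr ?(ltW Lam0)// exprn_ege1.
- rewrite lef_pV2 ?posrE ?mulr_gt0 ?exprn_gt0// addn1 exprS mulrCA ler_peMr ?(ltW k0R)//.
  by rewrite mulr_ege1// exprn_ege1.
- rewrite addn1 exprS; set z := _ ^+ _; have z0 : z != 0 by rewrite expf_neq0// gt_eqF.
  by field; rewrite z0 !gt_eqF.
Qed.

Lemma sqr_growth (b : R) (k : nat) :
  (b * (k ^ (2 * m))%:R ^+ d) ^+ 2 = b ^+ 2 * k%:R ^+ (4 * m * d).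
Proof. by rewrite exprMn natrX -!exprM; congr (_ * _ ^+ _); lia. Qed.

Lemma scale_exists (r0 L H0 : R) : 0 < r0 -> 0 <= L -> 0 <= H0 ->
  exists Lam : R, [/\ 324 <= Lam, Lam^-1 <= r0, 32 * H0 / Lam <= 1 & 2 * L * H0 / Lam <= 1].
Proof.
move=> r00 L0 H00; exists (324 + r0^-1 + 32 * H0 + 2 * L * H0).
have r0i : 0 < r0^-1 by rewrite invr_gt0.
have LH0 : 0 <= 2 * L * H0 by exact: mulr_ge0 (mulr_ge0 (ler0n _ 2) L0) H00.
set Lam := _ + 2 * L * H0.
have Lam0 : 0 < Lam by rewrite /Lam; lra.
split; first by rewrite /Lam; lra.
- by rewrite -[leRHS]invrK lef_pV2 ?posrE//; rewrite /Lam; lra.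
- by rewrite ler_pdivrMr// mul1r /Lam; lra.
- by rewrite ler_pdivrMr// mul1r /Lam; lra.
Qed.

Lemma exceptional_cover : exists2 Q : R, 0 < Q & forall k : nat, (1 <= k)%N ->
  exists W : seq (set (Xq Gam)),
    [/\ forall V, V \in W -> (ediam dX V <= (Q / k%:R)%:E)%E,
        forall x, exceptional k x -> exists2 V, V \in W & V x &
        (\sum_(V <- W) cover_term dX s V <= (Q / k%:R ^+ 2)%:E)%E].
Proof.
have [m0 m00 [r0 r00 Hball]] := ball_act_measure HB HGsub Hinv.
have [L L0 Hlip] := avg_Lipschitz a fK.
have [L' L'0 Hdiam] := ediam_ball_act.
pose H0 := (1 + C') ^+ 2; have H0_ge0 : 0 <= H0 by rewrite sqr_ge0.
have [Lam [Lam324 Lamr0 H0Lam H0Lam']] := scale_exists r00 (ltW L0) H0_ge0.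
have Lam1 : 1 <= Lam by lra.
have Lam0 : 0 < Lam by lra.
pose D := 2 * M ^+ 2 + C.
have D0 : 0 < D by rewrite /D ltr_wpDl// mulr_ge0// sqr_ge0.
pose Q1 := 2048 * D / m0 * Lam * (9 * L') `^ s.
have Q10 : 0 < Q1.
  apply: mulr_gt0; last by apply: powR_gt0; rewrite mulr_gt0.
  apply: mulr_gt0; last exact: Lam0.
  by apply: divr_gt0; [apply: mulr_gt0; [rewrite ltr0n|exact: D0]|exact: m00].
exists (Q1 + 9 * L'); first by rewrite addr_gt0// mulr_gt0.
move=> k k1; have [r [r_gt0 rLam rk rkk rs]] := radius_exists Lam1 k1.
have k1R : 1 <= (k%:R : R) by rewrite ler1n.
have k0R : 0 < (k%:R : R) by rewrite ltr0n.
have rr0 : r <= r0 by exact: le_trans Lamr0.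
have r324 : 324 * r <= 1.
  apply: (@le_trans _ _ (324 * Lam^-1)); first by rewrite ler_pM2l ?ltr0n.
  by rewrite ler_pdivrMr// mul1r.
pose N := (k ^ (2 * m))%N; have N0 : (0 < N)%N by rewrite expn_gt0 k1.
have N1R : 1 <= (N%:R : R) by rewrite ler1n.
(* Bounds the entries of every [u_(a_i)] with [i <= N], by the growth of [a]. *)
pose H := (1 + C') * N%:R ^+ d.
have Nd1 : 1 <= (N%:R : R) ^+ d by rewrite exprn_ege1.
have C'1 : 1 <= 1 + C' by rewrite lerDl ltW.
have H1 : 1 <= H by rewrite /H mulr_ege1.
have aH i : (1 <= i <= N)%N -> 1 + (a i)%:R <= H.
  move=> /andP[i1 iN]; rewrite /H mulrDl mul1r lerD//.
  apply: (le_trans (Hgrowth i1)); rewrite ler_pM2l//.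
  by rewrite lerXn2r ?nnegrE ?ler0n// ler_nat.
have H2r : H ^+ 2 * r = H0 / Lam / k%:R.
  by rewrite /H sqr_growth -mulrA rkk mulrA.
have ki0 : 0 < (k%:R : R)^-1 by rewrite invr_gt0.
have ki1 : (k%:R : R)^-1 <= 1 by rewrite invf_le1.
have cond32 : 32 * H ^+ 2 * r <= 1.
  rewrite -mulrA H2r; have -> : 32 * (H0 / Lam / k%:R) = (32 * H0 / Lam) * k%:R^-1 by rewrite !mulrA.
  apply: mulr_ile1; [|exact: (ltW ki0)|exact: H0Lam|exact: ki1].
  exact: divr_ge0 (mulr_ge0 (ler0n _ 32) H0_ge0) (ltW Lam0).
have condL : L * H ^+ 2 * r <= k%:R^-1 / 2.
  rewrite -mulrA H2r.
  have -> : L * (H0 / Lam / k%:R) = (2 * L * H0 / Lam) * (k%:R^-1 / 2).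
    by field; rewrite !gt_eqF.
  by rewrite ler_piMl// divr_ge0// ltW.
(* Averages vary by at most [1 / (2k)] on balls of radius [r], so halving the threshold makes room
   for whole balls around exceptional points. *)
pose E' : set X := [set x | (k%:R^-1 / 2 < `|avg f a x N|)%R].
have mE' : measurable E'.
  have mS : measurable_fun setT (fun x : X => `|avg f a x N|).
    apply: measurableT_comp => //; apply: measurable_funM => //; apply: measurable_sum => i.
    exact: (measurableT_comp mf (measurable_act HB HGsub (SL2_u _))).
  have -> : E' = (fun x : X => `|avg f a x N|) @^-1` `]k%:R^-1 / 2, +oo[.
    by apply/seteqP; split=> x /=; rewrite /E' /= in_itv/= andbT.
  by rewrite -[X in measurable X]setTI; exact: mS.
have muE' : (mu E' <= (4 * k%:R ^+ 2 * (D / k%:R ^+ 11))%:E)%E.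
  have h : 0 < (k%:R : R)^-1 / 2 by rewrite divr_gt0.
  apply: le_trans (avg_tail HB HGsub Hinv mf fM C0 Halpha Hmix Ha m11 am11 k1 h) _.
  rewrite lee_fin le_eqVlt; apply/orP; left; apply/eqP; rewrite /D.
  by field; rewrite gt_eqF.
pose v := m0 * (r / (8 * k%:R ^+ 2)) ^+ 3.
have v0 : 0 < v by rewrite mulr_gt0// exprn_gt0// divr_gt0// mulr_gt0// exprn_gt0.
have [|||l [lv lE lcov]] := @packing_cover R B Gam HB HGsub mu (exceptional k) E' r v v0 _ mE'.
- by lra.
- by move=> y [_ [g [Hg gk ->]]]; exact: Hball.
- move=> x [xk _] y xy; rewrite /E' /=.
  have := Hlip N H r x y aH cond32 xy N0 H1.
  have := ler_normD (avg f a x N - avg f a y N) (avg f a y N); rewrite subrK -/N in xk *.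
  lra.
exists [seq ball_act (9 * r) y | y <- l]; split.
- move=> _ /mapP[y _ ->]; apply: (le_trans (Hdiam _ _ _)); first lra.
  rewrite lee_fin; apply: (@le_trans _ _ (9 * L' * k%:R^-1)).
    have -> : L' * (9 * r) = 9 * L' * r by ring.
    by rewrite ler_pM2l// mulr_gt0.
  by rewrite ler_pM2r// lerDr ltW.
- move=> x /lcov[y yl xy]; exists (ball_act (9 * r) y) => //; exact: map_f.
have term y : (cover_term dX s (ball_act (9 * r) y) <= ((9 * L' * r) `^ s)%:E)%E.
  apply: cover_term_le; [exact: distX_ge0|exact: dimension_ge0| |].
    by rewrite !mulr_ge0// ltW.
  have -> : 9 * L' * r = L' * (9 * r) by ring.
  by apply: Hdiam; lra.
rewrite big_map; apply: (@le_trans _ _ (\sum_(y <- l) ((9 * L' * r) `^ s)%:E)%E).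
  by apply: lee_sum => y _; exact: term.
rewrite sumEFin lee_fin big_const_seq count_predT iter_addr_0.
have nv : (size l)%:R * v <= 4 * k%:R ^+ 2 * (D / k%:R ^+ 11).
  by rewrite -lee_fin; exact: le_trans muE'.
have L9 : 0 <= 9 * L' by rewrite mulr_ge0// ltW.
rewrite powRM ?(ltW r_gt0)// -[leLHS]mulr_natl.
apply: le_trans (block_sum_bound (ler0n R _) m00 r_gt0 k0R (ltW Lam0) (powR_ge0 _ _) nv rs) _.
by rewrite -/Q1 ler_pM2r ?invr_gt0 ?exprn_gt0// lerDl.
Qed.

(** Telescoping, from [1 / x^2 <= 2 (1 / x - 1 / (x + 1))] for [x >= 1]. *)
Lemma sum_inv_sqr_le (k0 n : nat) : (0 < k0)%N ->
  \sum_(j <- iota 0 n) ((k0 + j)%:R ^+ 2)^-1 <= 2 * (k0%:R^-1 - (k0 + n)%:R^-1) :> R.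
Proof.
move=> k00; elim: n => [|n IH]; first by rewrite big_nil addn0 subrr mulr0.
rewrite -addn1 iotaD big_cat /= big_seq1 add0n; apply: (le_trans (lerD IH (lexx _))).
rewrite addn1 addnS -[(k0 + n).+1%:R]natr1; set x := (k0 + n)%:R.
have x1 : 1 <= x by rewrite ler1n addn_gt0 k00.
have -> : x ^+ 2 = x * x by rewrite expr2.
have h : (x * x)^-1 <= 2 * (x^-1 - (x + 1)^-1).
  have -> : 2 * (x^-1 - (x + 1)^-1) = 2 * (x + 1)^-1 / x by field; apply/andP; split; rewrite gt_eqF//; lra.
  rewrite invfM ler_pM2r ?invr_gt0; last lra.
  by rewrite ler_pdivlMr ?addr_gt0// ?ler_pdivrMl; lra.
by lra.
Qed.

Lemma hdim_exceptional :
  (hdim (@distX R B Gam)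
     [set x | (0 < limn_esup (fun N => (`|avg f a x N|)%:E))%E] <= s%:E)%E.
Proof.
apply: hdim_le; first exact: dimension_ge0.
move=> delta eta delta0 eta0; have [Q Q0 HQ] := exceptional_cover.
(* The first summand brings the diameters [Q / k] below [delta], the second the tail sum [2 Q / k0]
   below [eta]. *)
pose k0 := (Num.bound (Q / delta) + Num.bound (2 * Q / eta)).+1.
have k00R : 0 < (k0%:R : R) by rewrite ltr0n.
have kd : Q / delta <= k0%:R.
  apply: (le_trans (ltW (archi_boundP (divr_ge0 (ltW Q0) (ltW delta0))))).
  by rewrite ler_nat; exact: leq_trans (leq_addr _ _) (leqnSn _).
have ke : 2 * Q / eta <= k0%:R.
  apply: (le_trans (ltW (archi_boundP (divr_ge0 (mulr_ge0 (ler0n _ 2) (ltW Q0)) (ltW eta0))))).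
  by rewrite ler_nat; exact: leq_trans (leq_addl _ _) (leqnSn _).
have /choice[W HW] : forall j, exists W : seq (set (Xq Gam)),
    [/\ forall V, V \in W -> (ediam dX V <= (Q / (k0 + j)%:R)%:E)%E,
        forall x, exceptional (k0 + j) x -> exists2 V, V \in W & V x &
        (\sum_(V <- W) cover_term dX s V <= (Q / (k0 + j)%:R ^+ 2)%:E)%E].
  by move=> j; apply: HQ; rewrite addn_gt0.
apply: (@hcontent_le_seq _ _ _ s delta eta _ W).
- move=> j V; have [h _ _] := HW j => /h /le_trans; apply; rewrite lee_fin.
  rewrite ler_pdivrMr ?ltr0n ?addn_gt0// mulrC -ler_pdivrMr//.
  by apply: (le_trans kd); rewrite ler_nat leq_addr.
- move=> x /limn_esup_gt0[e e0 He].
  have q0 : (0 < 2 * m)%N by rewrite muln_gt0 (leq_trans _ m11).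
  have [g Hg xg] := act_transitive x; have [n gn] := mxle_exists g.
  (* Beyond [k1] the representative [g] has entries at most [k], and [1 / k <= e / 2]. *)
  pose k1 := (k0 + n + Num.bound (2 / e))%N.
  have [k k1k ke2] := averages_subsequence q0 (fun i => fM (act (u (a i)%:R) x)) e0 He k1.
  have k0k : (k0 <= k)%N by apply: leq_trans k1k; rewrite /k1 -addnA leq_addr.
  exists (k - k0)%N; have [_ h _] := HW (k - k0)%N; apply: h; rewrite subnKC//.
  split; last first.
    exists g; split=> //; apply: mxleW gn; rewrite ler_nat.
    exact: leq_trans (leq_trans (leq_addl k0 n) (leq_addr _ _)) k1k.
  apply: le_lt_trans ke2.
  have kR : 2 / e <= k%:R.
    apply: (le_trans (ltW (archi_boundP (divr_ge0 (ler0n _ 2) (ltW e0))))).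
    by rewrite ler_nat; apply: leq_trans k1k; rewrite /k1 leq_addl.
  have kR0 : 0 < (k%:R : R) by rewrite ltr0n; exact: leq_trans k0k.
  rewrite invf_ple ?posrE ?divr_gt0// invf_div; exact: kR.
- move=> n; apply: (@le_trans _ _ (\sum_(j <- iota 0 n) (Q / (k0 + j)%:R ^+ 2)%:E)%E).
    by apply: lee_sum => j _; have [_ _ h] := HW j.
  rewrite sumEFin lee_fin -mulr_sumr.
  apply: (@le_trans _ _ (Q * (2 * k0%:R^-1))).
    rewrite ler_pM2l//; apply: (le_trans (sum_inv_sqr_le _ _)) => //.
    by rewrite ler_pM2l// lerBlDr lerDl invr_ge0.
  rewrite mulrA ler_pdivrMr// -ler_pdivrMl// mulrC (mulrC Q); exact: ke.
Qed.

End ExceptionalSet.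

Theorem mainTheorem2 (R : realType) (B : 'M[R]_(2 * 2)) (HB : posdef B)
  (Gam : set 'M[R]_2) (HGsub : is_subgroup Gam) (HGdisc : is_discrete Gam)
  (mu : probability (XM B Gam) R)
  (Hinv : forall g, SL2 g -> forall A : set (XM B Gam), measurable A ->
            mu (act g @^-1` A) = mu A)
  (d : nat) (alpha : R) (Halpha : 0 < alpha) :
  exists alpha' : R, 0 < alpha' /\
  forall (f : XM B Gam -> R) (C C' : R) (a : nat -> nat),
    (exists M : R, forall x, `|f x| <= M) ->
    (exists K : R, forall x y, (`|f x - f y|%:E <= K%:E * distX B x y)%E) ->
    (\int[mu]_x (f x)%:E = 0)%E ->
    0 < C ->
    (forall n : nat, (1 <= n)%N ->
       (`| \int[mu]_x ((f (act (u n%:R) x) * f x)%:E) | <= (C * n%:R `^ (- alpha))%:E)%E) ->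
    (forall n m : nat, (1 <= n)%N -> (n < m)%N -> (a n < a m)%N) ->
    0 < C' ->
    (forall n : nat, (1 <= n)%N -> (a n)%:R <= C' * n%:R ^+ d) ->
    (hdim (@distX R B Gam)
       [set x | (0 < limn_esup (fun N => (`|avg f a x N|)%:E))%E]
     <= (3 - alpha' / d%:R)%:E)%E.
Proof.
(* Ensures [m >= 11] and [alpha m >= 11], so that the tail bound holds with [p = 11]. Hence [alpha']
   depends on [alpha] alone. *)
pose m := (11 + Num.bound (11 / alpha))%N.
have m11 : (11 <= m)%N by exact: leq_addr.
have am11 : 11 <= alpha * m%:R.
  rewrite mulrC -ler_pdivrMr//.
  apply: (le_trans (ltW (archi_boundP (divr_ge0 (ler0n _ 11) (ltW Halpha))))).
  by rewrite ler_nat; exact: leq_addl.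
exists (8 * m%:R)^-1; split.
  by rewrite invr_gt0 mulr_gt0 ?ltr0n// (leq_trans _ m11).
move=> f C C' a [M fM] [K fK] _ C0 Hmix Ha C'0 Hgrowth.
(* For [d = 0] the growth bound would make a strictly increasing sequence of integers bounded, which
   is absurd. *)
case: d Hgrowth => [|d] Hgrowth.
  pose n := (Num.bound C').+2; have /= gap := strict_incr_gap Ha (leqnn 1) (isT : (1 <= n)%N).
  have := Hgrowth n isT; rewrite expr0 mulr1 leNgt => /negP[].
  apply: (lt_le_trans (archi_boundP (ltW C'0))); rewrite ler_nat.
  by apply: leq_trans gap; rewrite /n subn1 /= (leq_trans (leqnSn _))// leq_addl.
exact: (hdim_exceptional HB HGsub Hinv (ltn0Sn d) m11 am11 Halpha fM fK C0 Hmix Ha C'0 Hgrowth).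
Qed.
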